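(* Consider the discrete-time optimal control problem on $G\times\mathbb{R}^{n_x}$ with the data and standing assumptions (A-i)–(A-iii) described in the context: $$\min_{\{u_t\}_{t=0}^{N-1}}\ \sum_{t=0}^{N-1}c_t(q_t,x_t,u_t)+c_N(q_N,x_N)$$ subject to $q_{t+1}=q_t\,s_t(q_t,x_t)$, $x_{t+1}=f_t(q_t,x_t,u_t)$, $u_t\in\mathbb{U}_t$ for $t=0,\dots,N-1$; $g_t(q_t,x_t)\le 0$ (componentwise) for $t=1,\dots,N$; and $(q_0,x_0)=(\bar q_0,\bar x_0)$. Let $\{u^*_t\}_{t=0}^{N-1}$ be an optimal controller solving this problem, with corresponding state trajectory $\{(q^*_t,x^*_t)\}_{t=0}^N$. For $\nu\in\mathbb{R}$ define the Hamiltonian $$H^\nu(\tau,\zeta,\xi,q,x,u)=\nu\,c_\tau(q,x,u)+\langle\zeta,\exp^{-1}(s_\tau(q,x))\rangle_{\mathfrak g}+\langle\xi,f_\tau(q,x,u)\rangle\in\mathbb{R},$$ for $\tau\in\{0,\dots,N-1\}$, $\zeta\in\mathfrak g^*$, $\xi\in(\mathbb{R}^{n_x})^*$, $q\in G$, $x\in\mathbb{R}^{n_x}$, $u\in\mathbb{R}^{n_u}$. Then there exist an adjoint trajectory $\{(\zeta^t,\xi^t)\}_{t=0}^{N-1}\subset\mathfrak g^*\times(\mathbb{R}^{n_x})^*$, covectors $\mu^t\in(\mathbb{R}^{n_{g_t}})^*$ for $t=1,\dots,N$, and a scalar $\nu\in\{-1,0\}$ such that, with $$\gamma^*_t:=(t,\zeta^t,\xi^t,q^*_t,x^*_t,u^*_t),\qquad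 \rho^t:=\Big(\mathcal D\exp^{-1}\big(e^{\mathcal D_\zeta H^\nu(\gamma^*_t)}\big)\circ T_e\Phi_{e^{\mathcal D_\zeta H^\nu(\gamma^*_t)}}\Big)^{*}(\zeta^t)\in\mathfrak g^*,$$ the following hold: (i) State and adjoint dynamics: for $t=0,\dots,N-1$, $$q^*_{t+1}=q^*_t\,e^{\mathcal D_\zeta H^\nu(\gamma^*_t)},\qquad x^*_{t+1}=\mathcal D_\xi H^\nu(\gamma^*_t),$$ and for $t=1,\dots,N-1$, $$\rho^{t-1}=\mathrm{Ad}^*_{e^{-\mathcal D_\zeta H^\nu(\gamma^*_t)}}\rho^t+T_e^*\Phi_{q^*_t}\Big(\mathcal D_qH^\nu(\gamma^*_t)+\mu^t\mathcal D_qg_t(q^*_t,x^*_t)\Big),$$ $$\xi^{t-1}=\mathcal D_xH^\nu(\gamma^*_t)+\mu^t\mathcal D_xg_t(q^*_t,x^*_t).$$ (ii) Transversality: $$\rho^{N-1}=T_e^*\Phi_{q^*_N}\Big(\nu\mathcal D_qc_N(q^*_N,x^*_N)+\mu^N\mathcal D_qg_N(q^*_N,x^*_N)\Big),\qquad \xi^{N-1}=\nu\mathcal D_xc_N(q^*_N,x^*_N)+\mu^N\mathcal D_xg_N(q^*_N,x^*_N).$$ (iii) Hamiltonian non-positive gradient: for each $t=0,\dots,N-1$, $\langle\mathcal D_uH^\nu(\gamma^*_t),w-u^*_t\rangle\le 0$ for all $w\in\mathbb{U}_t$. (iv) Complementary slackness: $\mu^t_j\,g_t^j(q^*_t,x^*_t)=0$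 for all $j=1,\dots,n_{g_t}$ and $t=1,\dots,N$. (v) Non-positivity: $\mu^t\le 0$ (componentwise) for all $t=1,\dots,N$. (vi) Non-triviality: the adjoint variables $\{(\zeta^t,\xi^t)\}_{t=0}^{N-1}$, the covectors $\{\mu^t\}_{t=1}^N$ and the scalar $\nu$ do not simultaneously vanish.
   Context: Data: $N$ is a positive integer; $G$ is a (real, finite-dimensional) matrix Lie group with identity $e$, Lie algebra $\mathfrak g$ of dimension $n_q$, dual $\mathfrak g^*$, and exponential map $\exp:\mathfrak g\to G$, also written $e^{X}=\exp(X)$. Maps: $s_t:G\times\mathbb{R}^{n_x}\to G$, $f_t:G\times\mathbb{R}^{n_x}\times\mathbb{R}^{n_u}\to\mathbb{R}^{n_x}$, $c_t:G\times\mathbb{R}^{n_x}\times\mathbb{R}^{n_u}\to\mathbb{R}$ for $t=0,\dots,N-1$; $c_N:G\times\mathbb{R}^{n_x}\to\mathbb{R}$; $g_t=(g_t^1,\dots,g_t^{n_{g_t}}):G\times\mathbb{R}^{n_x}\to\mathbb{R}^{n_{g_t}}$ for $t=1,\dots,N$. The sets $\mathbb{U}_t\subset\mathbb{R}^{n_u}$ are nonempty, and $(\bar q_0,\bar x_0)\in G\times\mathbb{R}^{n_x}$ is fixed. An admissible state-action trajectory is a pair $(\{(q_t,x_t)\}_{t=0}^N,\{u_t\}_{t=0}^{N-1})$ satisfying all the constraints of the problem (dynamics, control constraints, state constraints, initial condition). Standing assumptions. (A-i) The maps $s_t,f_t,g_t,c_t,c_N$ are smooth. (A-ii) There is an open set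 $\mathcal O\subset\mathfrak g$ such that $\exp:\mathcal O\to\exp(\mathcal O)\subset G$ is a diffeomorphism and the integration steps satisfy $s_t(q_t,x_t)\in\exp(\mathcal O)$ for all $t=0,\dots,N-1$ along all admissible trajectories. (A-iii) $\mathbb{U}_t$ is convex for each $t=0,\dots,N-1$. Notation. $\exp^{-1}:\exp(\mathcal O)\to\mathcal O$ is the inverse of $\exp|_{\mathcal O}$; the Hamiltonian is considered at points with $s_\tau(q,x)\in\exp(\mathcal O)$. $\mathcal D$ denotes the derivative and $\mathcal D_y$ the partial derivative in the variable $y$; $\mathcal D_\zeta H^\nu$ is regarded as an element of $\mathfrak g\cong\mathfrak g^{**}$ (so $\mathcal D_\zeta H^\nu=\exp^{-1}(s_\tau(q,x))$) and $\mathcal D_\xi H^\nu$ as an element of $\mathbb{R}^{n_x}$. $\Phi_q:G\to G$, $\Phi_q(h)=qh$, is left multiplication, $T_e\Phi_q:\mathfrak g\to T_qG$ its derivative at $e$, and $T_e^*\Phi_q:T_q^*G\to\mathfrak g^*$ is given by $\langle T_e^*\Phi_q(a),w\rangle=\langle a,T_e\Phi_q(w)\rangle$ for $w\in\mathfrak g$. $\mathrm{Ad}_g\beta=\frac{d}{ds}\big|_{s=0}g e^{s\beta}g^{-1}$ for $\beta\in\mathfrak g$, and $\mathrm{Ad}_g^*:\mathfrak g^*\to\mathfrak g^*$ is its dual: $\langle\mathrm{Ad}_g^*a,\beta\rangle=\langle a,\mathrm{Ad}_g\beta\rangle$. In the definition of $\rho^t$, for $s\in\exp(\mathcal O)$ the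 linear map $\mathcal D\exp^{-1}(s)\circ T_e\Phi_s:\mathfrak g\to\mathfrak g$ has dual $(\cdot)^*:\mathfrak g^*\to\mathfrak g^*$. Covectors are row vectors; $\mu^t\mathcal D g_t=\sum_j\mu^t_j\mathcal D g_t^j$. *)

(* Defs.v *)
From HB Require Import structures.
From mathcomp Require Import all_boot all_order all_algebra.
From mathcomp Require Import all_classical all_reals all_analysis.

Set Implicit Arguments.
Unset Strict Implicit.
Unset Printing Implicit Defensive.

Import Order.TTheory GRing.Theory Num.Theory.
Import numFieldNormedType.Exports.

Local Open Scope classical_set_scope.
Local Open Scope ring_scope.

(* For finite-dimensional V and U open, this is membership in C^k(U). *)
Fixpoint Ck (R : realType) (V W : normedModType R) (k : nat)
    (U : set V) (f : V -> W) : Prop :=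
  match k with
  | 0 => forall x, U x -> {for x, continuous f}
  | k'.+1 => (forall x, U x -> differentiable f x) /\
             (forall v : V, Ck k' U (fun x => 'd f x v))
  end.

(* Smoothness of the restriction of f to an arbitrary subset A: existence of
   local smooth extensions.  When A is an embedded submanifold this is the
   intrinsic notion; the values of f outside A are irrelevant. *)
Definition smooth_on (R : realType) (V W : normedModType R)
    (A : set V) (f : V -> W) : Prop :=
  forall a, A a -> exists (U : set V) (F : V -> W),
    [/\ open U, U a, forall k, Ck k U F & forall x, U x -> A x -> F x = f x].

Definition open_in (T : topologicalType) (A B : set T) : Prop :=
  exists2 U : set T, open U & B = A `&` U.

Definition diffeo_on (R : realType) (V W : normedModType R)
    (A : set V) (B : set W) (f : V -> W) : Prop :=
  [/\ set_bij A B f, smooth_on A f & smooth_on B ('pinv_(fun=> 0) A f)].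

(* The derivative of phi at a column vector x, as a row vector. *)
Definition Drow (R : realType) (n : nat) (phi : 'cV[R]_n -> R) (x : 'cV[R]_n)
  : 'rV[R]_n := \row_j ('d (phi : 'cV[R]_n -> R^o) x (delta_mx j 0)).

(* The derivative of phi at a covector xi, as a column vector. *)
Definition Dcol (R : realType) (n : nat) (phi : 'rV[R]_n -> R) (xi : 'rV[R]_n)
  : 'cV[R]_n := \col_i ('d (phi : 'rV[R]_n -> R^o) xi (delta_mx 0 i)).

Definition expmx (R : realType) (m : nat) (X : 'M[R]_m) : 'M[R]_m :=
  lim (series (fun k : nat => (k`!%:R^-1 : R) *: X ^+ k) @ \oo).

(* Matrix Lie group: a subgroup of GL_m(R) that is closed in GL_m(R). *)
Definition matrix_lie_group (R : realType) (m : nat) (G : set 'M[R]_m) : Prop :=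
  [/\ forall X, G X -> X \in unitmx,
      G 1%:M,
      forall X Y, G X -> G Y -> G (X *m Y),
      forall X, G X -> G (invmx X) &
      forall X, X \in unitmx -> closure G X -> G X].

(* The set on the right is always a linear subspace when G is a matrix Lie
   group, so this determines g and can always be satisfied. *)
Definition lie_algebra_of (R : realType) (m : nat) (G : set 'M[R]_m)
    (g : {vspace 'M[R]_m}) : Prop :=
  forall X, X \in g <-> forall t : R, G (expmx (t *: X)).

Notation dualv g := 'Hom(subvs_of g, _^o).

Section LieGroup.
Context {R : realType} {m : nat}.
Implicit Types q s v : 'M[R]_m.

(* Phi q and TPhi q are left multiplication by q and its derivative at e.  The
   tangent space of G at q is TPhi q @` g. *)
Definition Phi q : 'M[R]_m -> 'M[R]_m := fun h => q *m h.
Definition TPhi q : 'M[R]_m -> 'M[R]_m := 'd (Phi q) (1%:M : 'M[R]_m).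

(* Derivative at q of a map F defined on (a neighbourhood of q in) G, in the
   direction v tangent to G at q.  It is computed along
   e |-> q * exp (e * (q^-1 * v)), a curve in G passing through q with
   velocity v: only the values of F on G matter. *)
Definition DG (W : normedModType R) (F : 'M[R]_m -> W) q v : W :=
  derive1 (fun e : R => F (q *m expmx (e *: (invmx q *m v)))) 0.

Context {g : {vspace 'M[R]_m}}.

(* Under the identification of g with its bidual: the vector representing the
   derivative of phi at zeta. *)
Definition Ddual (phi : dualv g -> R)
    (zeta : dualv g) : subvs_of g :=
  xget 0 [set Z : subvs_of g | forall d : dualv g,
    is_derive (0 : R) (1 : R) ((fun e : R => phi (zeta + e *: d)) : R -> R^o) (d Z)].

Definition Ad s (b : subvs_of g) : subvs_of g :=
  vsproj g (derive1 (fun r : R => s *m expmx (r *: vsval b) *m invmx s) 0).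

(* Covectors obtained by dualizing a linear map are given as functions on g. *)
Definition AdStar s (a : subvs_of g -> R) : subvs_of g -> R :=
  fun b => a (Ad s b).

Definition TPhiStar q (a : 'M[R]_m -> R) : subvs_of g -> R :=
  fun w => a (TPhi q (vsval w)).

(* The inverse of exp restricted to O. *)
Definition logmx (O : set 'M[R]_m) : 'M[R]_m -> 'M[R]_m :=
  'pinv_(fun=> 0) O (@expmx R m).

(* (D exp^-1 (s) \o T_e Phi_s)^* zeta *)
Definition DlogStar (O : set 'M[R]_m) s (zeta : dualv g)
  : subvs_of g -> R :=
  fun w => zeta (vsproj g (DG (logmx O) s (TPhi s (vsval w)))).

End LieGroup.

(* The data are total functions of an ambient matrix q; only their values at
   q in G matter. *)
Record ocp (R : realType) (m nx nu : nat) := OCP {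
  horizon : nat;
  gstep : nat -> 'M[R]_m -> 'cV[R]_nx -> 'M[R]_m;
  dyn : nat -> 'M[R]_m -> 'cV[R]_nx -> 'cV[R]_nu -> 'cV[R]_nx;
  cost : nat -> 'M[R]_m -> 'cV[R]_nx -> 'cV[R]_nu -> R;
  cost_end : 'M[R]_m -> 'cV[R]_nx -> R;
  ncstr : nat -> nat;
  cstr : forall t : nat, 'M[R]_m -> 'cV[R]_nx -> 'cV[R]_(ncstr t);
  ctrl : nat -> set 'cV[R]_nu;
  q_init : 'M[R]_m;
  x_init : 'cV[R]_nx
}.

Section OptimalControl.
Context {R : realType} {m nx nu : nat}.
Variables (P : ocp R m nx nu) (G : set 'M[R]_m).
Local Notation N := (horizon P).

(* Trajectories are infinite sequences of which only q 0, .., q N, x 0, .., x N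
   and u 0, .., u (N - 1) are used. *)
Definition admissible (q : nat -> 'M[R]_m) (x : nat -> 'cV[R]_nx)
    (u : nat -> 'cV[R]_nu) : Prop :=
  [/\ forall t, (t <= N)%N -> G (q t),
      q 0%N = q_init P /\ x 0%N = x_init P,
      forall t, (t < N)%N ->
        [/\ q t.+1 = q t *m gstep P t (q t) (x t),
            x t.+1 = dyn P t (q t) (x t) (u t) &
            ctrl P t (u t)] &
      forall t, (0 < t <= N)%N ->
        forall j, cstr P t (q t) (x t) j 0 <= 0].

Definition total_cost (q : nat -> 'M[R]_m) (x : nat -> 'cV[R]_nx)
    (u : nat -> 'cV[R]_nu) : R :=
  \sum_(t < N) cost P t (q t) (x t) (u t) + cost_end P (q N) (x N).

Definition optimal (q : nat -> 'M[R]_m) (x : nat -> 'cV[R]_nx)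
    (u : nat -> 'cV[R]_nu) : Prop :=
  admissible q x u /\
  forall q' x' u', admissible q' x' u' -> total_cost q x u <= total_cost q' x' u'.

Definition well_posed : Prop :=
  [/\ (0 < N)%N,
      forall t, (t < N)%N -> forall q x, G q -> G (gstep P t q x),
      forall t, (t < N)%N -> ctrl P t !=set0 &
      G (q_init P)].

Definition smooth_data : Prop :=
  [/\ forall t, (t < N)%N ->
        smooth_on [set p : 'M[R]_m * 'cV[R]_nx | G p.1]
          (fun p => gstep P t p.1 p.2),
      forall t, (t < N)%N ->
        smooth_on [set p : 'M[R]_m * 'cV[R]_nx * 'cV[R]_nu | G p.1.1]
          (fun p => dyn P t p.1.1 p.1.2 p.2),
      forall t, (t < N)%N ->
        smooth_on [set p : 'M[R]_m * 'cV[R]_nx * 'cV[R]_nu | G p.1.1]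
          (fun p => cost P t p.1.1 p.1.2 p.2 : R^o),
      smooth_on [set p : 'M[R]_m * 'cV[R]_nx | G p.1]
        (fun p => cost_end P p.1 p.2 : R^o) &
      forall t, (0 < t <= N)%N ->
        smooth_on [set p : 'M[R]_m * 'cV[R]_nx | G p.1]
          (fun p => cstr P t p.1 p.2)].

Section Hamiltonian.
Context {g : {vspace 'M[R]_m}}.
Variable O : set 'M[R]_m.

(* That exp @` O is open in G is part of exp being a diffeomorphism onto it, G
   and g having the same dimension. *)
Definition exp_chart : Prop :=
  [/\ open_in [set` g] O,
      open_in G (@expmx R m @` O),
      diffeo_on O (@expmx R m @` O) (@expmx R m) &
      forall q x u, admissible q x u -> forall t, (t < N)%N ->
        (@expmx R m @` O) (gstep P t (q t) (x t))].

Definition Ham (nu_ : R) (t : nat) (zeta : dualv g) (xi : 'rV[R]_nx)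
    (q : 'M[R]_m) (x : 'cV[R]_nx) (u : 'cV[R]_nu) : R :=
  nu_ * cost P t q x u + zeta (vsproj g (logmx O (gstep P t q x)))
  + (xi *m dyn P t q x u) 0 0.

Variables (nu_ : R) (t : nat) (zeta : dualv g) (xi : 'rV[R]_nx)
  (q : 'M[R]_m) (x : 'cV[R]_nx) (u : 'cV[R]_nu).

Definition DzetaH : subvs_of g := Ddual (fun z => Ham nu_ t z xi q x u) zeta.
Definition DxiH : 'cV[R]_nx := Dcol (fun y => Ham nu_ t zeta y q x u) xi.
Definition DqH : 'M[R]_m -> R :=
  DG ((fun h => Ham nu_ t zeta xi h x u) : 'M[R]_m -> R^o) q.
Definition DxH : 'rV[R]_nx := Drow (fun y => Ham nu_ t zeta xi q y u) x.
Definition DuH : 'rV[R]_nu := Drow (fun w => Ham nu_ t zeta xi q x w) u.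

End Hamiltonian.

Section Constraints.
Variables (t : nat) (mu : 'rV[R]_(ncstr P t)) (q : 'M[R]_m) (x : 'cV[R]_nx).

Definition muDqg : 'M[R]_m -> R := fun v =>
  \sum_j mu 0 j * DG ((fun h => cstr P t h x j 0) : 'M[R]_m -> R^o) q v.
Definition muDxg : 'rV[R]_nx :=
  \sum_j mu 0 j *: Drow (fun y => cstr P t q y j 0) x.

End Constraints.

Definition Dqcend (q : 'M[R]_m) (x : 'cV[R]_nx) : 'M[R]_m -> R :=
  DG ((fun h => cost_end P h x) : 'M[R]_m -> R^o) q.
Definition Dxcend (q : 'M[R]_m) (x : 'cV[R]_nx) : 'rV[R]_nx :=
  Drow (cost_end P q) x.

End OptimalControl.

(* Main.v *)
(* A control sequence determines the whole trajectory, so the problem is the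
   minimization of a function of [u] over a product of convex sets under the
   inequality constraints alone.  At an optimum no admissible variation [v] of
   the controls decreases the cost and every active constraint to first order:
   moving along [u + e v] stays in the control sets by convexity.  A theorem of
   the alternative for linear forms on a convex set (by induction on the number
   of forms) then gives nonnegative multipliers, i.e. [nu] and [mu].

   With these fixed, the adjoint equations are solved backwards in time: [zeta^t]
   can be recovered from [rho^t] because the derivative of [log] at [s],
   precomposed with left translation, is a bijection of the Lie algebra.  The
   pairing of the adjoint variables with the first-order variation of the state
   telescopes, so the sum over [t] of [D_u H (v_t)] is the multiplier
   combination of the derivatives of the cost and the constraints, which is
   nonpositive; varying one control at a time gives the gradient condition.

   The variations of the state lie in the tangent spaces of [G] because a curve
   [c] in [G] through the identity satisfies [c (t / n) ^ n --> exp (t c'(0))]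
   and [G] is closed in the invertible matrices. *)

Require Import Defs.
From HB Require Import structures.
From mathcomp Require Import all_boot all_order all_algebra.
From mathcomp Require Import all_classical all_reals all_analysis.
From mathcomp Require Import ring lra zify.
Import Order.TTheory GRing.Theory Num.Theory.
Import numFieldNormedType.Exports.
Local Open Scope classical_set_scope.
Local Open Scope ring_scope.

Set Implicit Arguments.
Unset Strict Implicit.
Unset Printing Implicit Defensive.

(** * Matrix norm and exponential *)

Lemma mx_entry_le (R : realType) (m n : nat) (A : 'M[R]_(m, n)) i j :
  `|A i j| <= `|A|.
Proof.
by rewrite [leRHS]/Num.Def.normr /= mx_normrE; exact: (le_bigmax _ _ (i, j)).
Qed.

Lemma mx_norm_le (R : realType) (m n : nat) (A : 'M[R]_(m, n)) e :
  0 <= e -> (forall i j, `|A i j| <= e) -> `|A| <= e.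
Proof.
by move=> e0 Ae; rewrite /Num.Def.normr /= mx_normrE bigmax_le // => -[].
Qed.

(** The norm is the largest absolute value of an entry, which is not submultiplicative: the factor
    [n%:R] counts the summands in an entry of the product. For square matrices this is why
    [m%:R * |X|] appears in all the estimates on powers below. *)
Lemma mx_norm_mul (R : realType) (m n p : nat) (A : 'M[R]_(m, n))
    (B : 'M[R]_(n, p)) : `|A *m B| <= n%:R * `|A| * `|B|.
Proof.
apply: mx_norm_le => [|i j]; first by rewrite !mulr_ge0.
rewrite mxE (le_trans (ler_norm_sum _ _ _))//.
have -> : n%:R * `|A| * `|B| = \sum_(k < n) `|A| * `|B|.
  by rewrite sumr_const card_ord -mulrA mulr_natl.
by apply: ler_sum => k _; rewrite normrM ler_pM// mx_entry_le.
Qed.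

Lemma cvg_mulmx (R : realType) (m n p : nat) (T : Type) (F : set_system T)
    (FF : Filter F) (f : T -> 'M[R]_(m, n)) (h : T -> 'M[R]_(n, p))
    (a : 'M[R]_(m, n)) (b : 'M[R]_(n, p)) :
  f @ F --> a -> h @ F --> b -> (fun x => f x *m h x) @ F --> a *m b.
Proof.
move=> fa hb; apply/subr_cvg0/norm_cvg0P.
have fa0 : `|f x - a| @[x --> F] --> (0 : R^o) by exact/norm_cvg0P/subr_cvg0.
have hb0 : `|h x - b| @[x --> F] --> (0 : R^o) by exact/norm_cvg0P/subr_cvg0.
have hn : `|h x| @[x --> F] --> `|b| by exact: cvg_norm.
pose B x := n%:R * `|f x - a| * `|h x| + n%:R * `|a| * `|h x - b|.
have B0 : B x @[x --> F] --> (0 : R).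
  rewrite (_ : 0 = n%:R * 0 * `|b| + n%:R * `|a| * 0); last first.
    by rewrite !mulr0 mul0r addr0.
  by apply: cvgD; apply: cvgM => //; apply: cvgM => //; exact: cvg_cst.
apply: (@squeeze_cvgr _ _ _ _ (cst 0) B) => //; last exact: cvg_cst.
apply: nearW => x /=; rewrite normr_ge0 /=.
have -> : f x *m h x - a *m b = (f x - a) *m h x + a *m (h x - b).
  by rewrite mulmxBl mulmxBr addrA subrK.
by rewrite (le_trans (ler_normD _ _))// lerD// mx_norm_mul.
Qed.

Lemma sum_triangle (V : nmodType) (F : nat -> nat -> V) n :
  \sum_(0 <= k < n) \sum_(0 <= i < k.+1) F i (k - i)%N =
  \sum_(0 <= i < n) \sum_(0 <= j < n - i) F i j.
Proof.
elim: n => [|n IH]; first by rewrite !big_nil.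
rewrite big_nat_recr//= IH [RHS]big_nat_recr//= subSnn big_nat1.
rewrite [in LHS]big_nat_recr//= subnn addrA; congr (_ + _).
rewrite -big_split/= big_nat_cond [RHS]big_nat_cond.
apply: eq_bigr => i; rewrite andbT => /andP[_ i_n].
by rewrite subSn ?(ltnW i_n)// [RHS]big_nat_recr.
Qed.

Section Expmx.
Context {R : realType} {m : nat}.
Implicit Types X : 'M[R]_m.

Let ecoef (s : R) i : R := s ^+ i / i`!%:R.

Lemma mx_norm_expr X k : `|X ^+ k| <= (m%:R * `|X|) ^+ k.
Proof.
elim: k => [|k IH].
  rewrite !expr0; apply: mx_norm_le => // i j.
  by rewrite mxE; case: (_ == _); rewrite ?normr1 ?normr0.
rewrite !exprS (le_trans (mx_norm_mul _ _))//.
by rewrite ler_wpM2l// mulr_ge0.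
Qed.

Lemma mx_exprZ (r : R) X k : (r *: X) ^+ k = r ^+ k *: X ^+ k.
Proof.
elim: k => [|k IH]; first by rewrite !expr0 scale1r.
rewrite !exprS IH -!(@erefl _ (_ *m _) : _ *m _ = _ * _).
by rewrite -scalemxAl -scalemxAr scalerA.
Qed.

Let eser X := series (fun k : nat => (k`!%:R^-1 : R) *: X ^+ k).

Lemma expmx_term_le X k : `|(k`!%:R^-1 : R) *: X ^+ k| <= ecoef (m%:R * `|X|) k.
Proof.
rewrite normrZ mulrC /ecoef ler_pM// ?mx_norm_expr//.
by rewrite ger0_norm.
Qed.

(** The terms are dominated by those of the scalar exponential series at [m%:R * |X|], so the series
    converges absolutely, and completeness of the matrix space gives its convergence. *)
Lemma cvg_expmx X : eser X @ \oo --> expmx X.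
Proof.
suff : cvgn (eser X) by [].
have : cvgn [normed series (fun k : nat => (k`!%:R^-1 : R) *: X ^+ k)].
  apply: series_le_cvg (is_cvg_series_exp_coeff (m%:R * `|X|)) => n.
  - exact: normr_ge0.
  - by rewrite exp_coeff_ge0// mulr_ge0.
  - exact: expmx_term_le.
move=> /cauchy_cvgP/cauchy_seriesP ucvg.
apply: (@cauchy_cvg 'M[R]_m); apply/cauchy_seriesP => e /ucvg.
apply: filterS => n /=; rewrite ger0_norm ?sumr_ge0//.
by apply: le_lt_trans; exact: ler_norm_sum.
Qed.

(* Splitting the square [i, j < n] along [i + j < n] leaves, in the difference
   of the two sides below, only coefficients [s ^ i * t ^ j / (i! j!)] with
   [n <= i + j]. *)
Lemma exp_sumD (V : lmodType R) (Y : nat -> V) s t n :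
  \sum_(0 <= i < n) \sum_(0 <= j < n) (ecoef s i * ecoef t j) *: Y (i + j)%N -
  \sum_(0 <= k < n) ecoef (s + t) k *: Y k =
  \sum_(0 <= i < n) \sum_(n - i <= j < n) (ecoef s i * ecoef t j) *: Y (i + j)%N.
Proof.
pose F i j := (ecoef s i * ecoef t j) *: Y (i + j)%N.
have -> : \sum_(0 <= k < n) ecoef (s + t) k *: Y k =
    \sum_(0 <= i < n) \sum_(0 <= j < n - i) F i j.
  rewrite -sum_triangle; apply: eq_bigr => k _.
  rewrite /ecoef addrC exprDn mulr_suml scaler_suml big_mkord.
  apply: eq_bigr => -[i /=]; rewrite ltnS => ik _.
  rewrite /F subnKC//; congr (_ *: _).
  rewrite -mulr_natr -(bin_fact ik) !natrM.
  have u0 := bin_gt0 k i.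
  rewrite ik -(ltr0n R) in u0.
  have vi : (0 : R) < i`!%:R by rewrite ltr0n fact_gt0.
  have vk : (0 : R) < (k - i)`!%:R by rewrite ltr0n fact_gt0.
  rewrite /ecoef; field.
  by rewrite !gt_eqF.
rewrite -sumrB; apply: eq_bigr => i _.
rewrite (@big_cat_nat _ _ _ (n - i))//= ?leq_subr//.
by rewrite addrAC subrr add0r.
Qed.

(** The defect between the product of partial sums and the partial sum for [s + t] is bounded by the
    same defect for the scalar series at [|s| * a] and [|t| * a]. The scalar defect tends to 0
    because [expR] turns sums into products. *)
Lemma expmx_addZ s t X : expmx (s *: X) *m expmx (t *: X) = expmx ((s + t) *: X).
Proof.
pose a := m%:R * `|X|.
have a0 : 0 <= a by rewrite mulr_ge0.
have eserE r n : eser (r *: X) n = \sum_(0 <= k < n) ecoef r k *: X ^+ k.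
  rewrite /eser /series /=; apply: eq_bigr => k _.
  by rewrite mx_exprZ scalerA /ecoef mulrC.
have sserE r n : series (exp_coeff (r * a)) n =
    \sum_(0 <= k < n) ecoef r k *: (a ^+ k : R^o).
  rewrite /series /=; apply: eq_bigr => k _.
  by rewrite /exp_coeff /= exprMn /ecoef -mulrA [_ / _]mulrC mulrA.
(* The remainder is generic in the sequence [Y] of powers, so that it can be taken both for the
   powers of [X] and for those of the real number [a]. *)
pose D (V : lmodType R) (Y : nat -> V) s t n :=
  \sum_(0 <= i < n) \sum_(n - i <= j < n) (ecoef s i * ecoef t j) *: Y (i + j)%N.
have DX n : eser (s *: X) n *m eser (t *: X) n - eser ((s + t) *: X) n =
    D 'M[R]_m (fun k => X ^+ k) s t n.
  rewrite /D -exp_sumD !eserE; congr (_ - _).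
  rewrite mulmx_suml; apply: eq_bigr => i _.
  rewrite mulmx_sumr; apply: eq_bigr => j _.
  by rewrite -scalemxAl -scalemxAr scalerA exprD.
have Da n : series (exp_coeff (`|s| * a)) n * series (exp_coeff (`|t| * a)) n -
    series (exp_coeff ((`|s| + `|t|) * a)) n =
    D R^o (fun k => a ^+ k) `|s| `|t| n.
  rewrite /D -exp_sumD !sserE; congr (_ - _).
  rewrite mulr_suml; apply: eq_bigr => i _.
  rewrite mulr_sumr; apply: eq_bigr => j _.
  by rewrite /GRing.scale/= exprD; ring.
have D_le n : `|D 'M[R]_m (fun k => X ^+ k) s t n| <=
    D R^o (fun k => a ^+ k) `|s| `|t| n.
  apply: (le_trans (ler_norm_sum _ _ _)); apply: ler_sum => i _.
  apply: (le_trans (ler_norm_sum _ _ _)); apply: ler_sum => j _.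
  rewrite normrZ [leRHS]/GRing.scale/=.
  apply: ler_pM; rewrite ?mx_norm_expr//.
  rewrite /ecoef !normrM !normfV !normrX.
  by rewrite ![`|_%:R|]ger0_norm ?ler0n.
apply/eqP; rewrite -subr_eq0; apply/eqP.
have L1 : (fun n => eser (s *: X) n *m eser (t *: X) n - eser ((s + t) *: X) n)
    @ \oo --> expmx (s *: X) *m expmx (t *: X) - expmx ((s + t) *: X).
  apply: (@cvgB _ ('M[R]_m : normedModType R)); last exact: cvg_expmx.
  by apply: cvg_mulmx; exact: cvg_expmx.
have L2 : D R^o (fun k => a ^+ k) `|s| `|t| n @[n --> \oo] --> (0 : R).
  have -> : 0 = expR (`|s| * a) * expR (`|t| * a) - expR ((`|s| + `|t|) * a).
    by rewrite mulrDl expRD subrr.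
  under eq_fun do rewrite -Da.
  apply: cvgB; last exact: is_cvg_series_exp_coeff.
  by apply: cvgM; exact: is_cvg_series_exp_coeff.
have L3 : (fun n => eser (s *: X) n *m eser (t *: X) n - eser ((s + t) *: X) n)
    @ \oo --> (0 : 'M[R]_m).
  apply/norm_cvg0P.
  apply: (@squeeze_cvgr _ _ _ _ (cst 0) (D R^o (fun k => a ^+ k) `|s| `|t|)) => //.
    by apply: nearW => n /=; rewrite normr_ge0 DX D_le.
  exact: cvg_cst.
exact: (cvg_unique _ L1 L3).
Qed.

(** For [k >= 2] and [|t| <= 1], [|t| ^+ k] is at most [t ^+ 2]. Factoring this out leaves a tail of
    the scalar exponential series, bounded by the whole series. The bound is proved on partial sums
    and passes to the limit. *)
Lemma expmx_taylor1 t X : `|t| <= 1 ->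
  `|expmx (t *: X) - 1%:M - t *: X| <= t ^+ 2 * expR (m%:R * `|X|).
Proof.
move=> t1; set a := m%:R * `|X|.
have a0 : 0 <= a by rewrite mulr_ge0.
pose v n := `|eser (t *: X) n - 1%:M - t *: X|.
pose w n := t ^+ 2 * series (exp_coeff a) n.
have vl : v n @[n --> \oo] --> (`|expmx (t *: X) - 1%:M - t *: X| : R).
  apply: cvg_norm; apply: (@cvgB _ ('M[R]_m : normedModType R)); last exact: cvg_cst.
  by apply: (@cvgB _ ('M[R]_m : normedModType R)); [exact: cvg_expmx|exact: cvg_cst].
have wl : w n @[n --> \oo] --> (t ^+ 2 * expR a : R).
  by apply: cvgM; [exact: cvg_cst|exact: is_cvg_series_exp_coeff].
apply: (ler_cvg_to vl wl); near=> n.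
have n2 : (2 <= n)%N by near: n; exact: nbhs_infty_ge.
rewrite /v /w /eser /series /=.
have Hs (x y z : 'M[R]_m) : x + y + z - x - y = z.
  by rewrite -[x + y + z]addrA (addrC x) addrK (addrC y) addrK.
have -> : \sum_(0 <= k < n) (k`!%:R^-1 : R) *: (t *: X) ^+ k =
    1%:M + t *: X + \sum_(2 <= k < n) (k`!%:R^-1 : R) *: (t *: X) ^+ k.
  rewrite big_ltn ?(ltn_trans _ n2)// big_ltn// addrA expr0 expr1.
  by rewrite fact0 (_ : 1`! = 1)%N// invr1 !scale1r.
rewrite Hs.
apply: (le_trans (ler_norm_sum _ _ _)).
rewrite mulr_sumr [leRHS](@big_cat_nat _ _ _ 2)//= -[leLHS]add0r.
apply: lerD.
  by rewrite sumr_ge0// => k _; rewrite mulr_ge0 ?sqr_ge0 ?exp_coeff_ge0.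
rewrite [leLHS]big_nat_cond [leRHS]big_nat_cond.
apply: ler_sum => k; rewrite andbT => /andP[k2 _].
rewrite mx_exprZ scalerA normrZ /exp_coeff /= mulrA.
rewrite normrM normfV [`|_%:R|]ger0_norm//.
rewrite [_^-1 * _]mulrC mulrAC ler_wpM2r ?invr_ge0//.
have -> : t ^+ 2 = `|t| ^+ 2 by rewrite -normrX ger0_norm ?sqr_ge0.
rewrite normrX ler_pM ?exprn_ge0 ?mx_norm_expr//.
by rewrite ler_wiXn2l// normr_ge0.
Unshelve. all: by end_near. Qed.

End Expmx.

Lemma is_derive1P (R : realType) (V : normedModType R) (f : R -> V) (a : R) v :
  is_derive a 1 f v <-> h^-1 *: (f (h + a) - f a) @[h --> 0^'] --> v.
Proof.
have E : (fun h : R => h^-1 *: (f (h + a) - f a)) =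
    (fun h => h^-1 *: ((f \o shift a) (h *: 1) - f a)).
  by apply/funext => h /=; rewrite [h *: 1]mulr1.
rewrite E; split => [[dfa <-]|fav]; first exact: dfa.
split; first by apply/cvg_ex; exists v.
exact: (cvg_lim _ fav).
Qed.

(** * Curves through the identity and one-parameter subgroups *)

Section ExpmxCurves.
Context {R : realType} {m : nat}.
Implicit Types (X A B : 'M[R]_m) (c : R -> 'M[R]_m).

Lemma expmx0 : expmx (0 : 'M[R]_m) = 1%:M.
Proof.
have := @expmx_taylor1 R m 0 0; rewrite normr0 scale0r subr0 expr0n/= mul0r.
by move=> /(_ ler01); rewrite normr_le0 subr_eq0 => /eqP.
Qed.

Lemma is_derive_expmx X : is_derive (0 : R) 1 (fun t => expmx (t *: X)) X.
Proof.
apply/is_derive1P; apply/cvgrPdist_le => e e0.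
pose K := expR (m%:R * `|X|).
have K0 : 0 < K by exact: expR_gt0.
near=> h.
have h0 : h != 0 by near: h; exact: nbhs_dnbhs_neq.
have h1 : `|h| <= 1 by near: h; exact: dnbhs0_le.
have hK : `|h| <= e / K by near: h; apply: dnbhs0_le; rewrite divr_gt0.
rewrite addr0 scale0r expmx0 distrC.
have -> : h^-1 *: (expmx (h *: X) - 1%:M) - X =
    h^-1 *: (expmx (h *: X) - 1%:M - h *: X).
  by rewrite [RHS]scalerBr scalerA mulVf// scale1r.
rewrite normrZ normfV ler_pdivrMl ?normr_gt0//.
apply: (le_trans (expmx_taylor1 X h1)); rewrite -/K.
have -> : h ^+ 2 = `|h| ^+ 2 by rewrite -normrX ger0_norm ?sqr_ge0.
by rewrite expr2 -mulrA ler_wpM2l// -ler_pdivlMr.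
Unshelve. all: by end_near. Qed.

Lemma expmx_mulN X : expmx X *m expmx (- X) = 1%:M.
Proof.
by rewrite -[X]scale1r -scaleNr expmx_addZ subrr scale0r expmx0.
Qed.

Lemma expmx_unit X : expmx X \in unitmx.
Proof. by have /mulmx1_unit[] := expmx_mulN X. Qed.

Lemma invmx_expmx X : invmx (expmx X) = expmx (- X).
Proof.
by rewrite -[invmx _]mulmx1 -(expmx_mulN X) mulmxA mulVmx ?expmx_unit// mul1mx.
Qed.

Lemma expmx_natmul X k : expmx (k%:R *: X) = expmx X ^+ k.
Proof.
elim: k => [|k IH]; first by rewrite scale0r expmx0 expr0.
have -> : k.+1%:R *: X = (1 + k%:R) *: X by rewrite -natr1 addrC.
by rewrite -expmx_addZ scale1r IH exprS.
Qed.

(** Writing [A] as the identity plus a small matrix avoids the factor [m%:R] on the main term;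
    otherwise this factor would accumulate in high powers of [A]. *)
Lemma mx_norm_mul_near1 A (d : R) (Y : 'M[R]_m) :
  m%:R * `|A - 1%:M| <= d -> `|A *m Y| <= (1 + d) * `|Y|.
Proof.
move=> Ad; have -> : A *m Y = Y + (A - 1%:M) *m Y.
  by rewrite mulmxBl mul1mx addrCA subrr addr0.
rewrite (le_trans (ler_normD _ _))// mulrDl mul1r lerD2l.
by rewrite (le_trans (mx_norm_mul _ _))// ler_wpM2r.
Qed.

(** Telescoping through [A ^+ k.+1 - B ^+ k.+1 = A (A ^+ k - B ^+ k) + (A - B) B ^+ k]. The growth
    factor [(1 + d) ^+ k] stays bounded when [k] grows with [k * d] fixed, which is how the estimate
    is used. *)
Lemma mx_norm_subX A B (d : R) k :
  m%:R * `|A - 1%:M| <= d -> m%:R * `|B - 1%:M| <= d ->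
  `|A ^+ k - B ^+ k| <= k%:R * (m%:R * `|A - B|) * (1 + d) ^+ k.
Proof.
move=> Ad Bd; have d0 : 0 <= d by rewrite (le_trans _ Ad)// mulr_ge0.
have d1 : 0 <= 1 + d by rewrite addr_ge0.
have BX j : `|B ^+ j| <= (1 + d) ^+ j.
  elim: j => [|j IH]; first by have := mx_norm_expr B 0; rewrite !expr0.
  rewrite !exprS (le_trans (mx_norm_mul_near1 _ Bd))//.
  by rewrite ler_wpM2l.
elim: k => [|k IH]; first by rewrite !expr0 subrr normr0 !mul0r.
have -> : A ^+ k.+1 - B ^+ k.+1 = A *m (A ^+ k - B ^+ k) + (A - B) *m B ^+ k.
  by rewrite !exprS mulmxBr mulmxBl addrA subrK.
rewrite (le_trans (ler_normD _ _))// -natr1 2!mulrDl mul1r lerD//.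
  rewrite (le_trans (mx_norm_mul_near1 _ Ad))// exprS mulrCA.
  by rewrite ler_wpM2l.
rewrite (le_trans (mx_norm_mul _ _))// ler_wpM2l ?mulr_ge0//.
by rewrite (le_trans (BX k))// exprS ler_peMl ?exprn_ge0// lerDl.
Qed.

(** The matrices [c (t / n.+1) ^+ n.+1] eventually lie in [G] and tend to [expmx (t *: X)], because
    [c] and the one-parameter group of [X] agree to first order at 0. The limit is invertible, so
    closedness of [G] in the invertible matrices applies. *)
Lemma lie_group_velocity (G : set 'M[R]_m) c X :
  matrix_lie_group G -> c 0 = 1%:M -> is_derive (0 : R) 1 c X ->
  (\forall e \near (0 : R), G (c e)) -> forall t : R, G (expmx (t *: X)).
Proof.
move=> [Gunit G1 GM GV Gcl] c0 dc Gc t.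
(* The case [t = 0] is separate because [h n] below has to approach 0 through nonzero values to be
   used in difference quotients. *)
have [->|t0] := eqVneq t 0; first by rewrite scale0r expmx0.
apply: Gcl; first exact: expmx_unit.
pose h n : R := t / n.+1%:R.
have h0 n : h n != 0 by rewrite mulf_neq0// invr_eq0 pnatr_eq0.
have hcvg : h @ \oo --> (0 : R).
  rewrite -(mulr0 t); apply: cvgM; [exact: cvg_cst|exact: cvg_harmonic].
have hd : h @ \oo --> (0 : R)^'.
  move=> N /hcvg HN; have : \forall n \near \oo, h n != 0 -> N (h n) by exact: HN.
  by apply: filterS => n; apply.
have GX A k : G A -> G (A ^+ k).
  by move=> GA; elim: k => [|k IH]; rewrite ?expr0// exprS; exact: GM.
pose dA n := (h n)^-1 *: (c (h n) - 1%:M).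
pose dB n := (h n)^-1 *: (expmx (h n *: X) - 1%:M).
have dAX : dA n @[n --> \oo] --> X.
  have := cvg_comp _ _ hd ((is_derive1P _ _ _).1 dc).
  by rewrite /comp; under eq_fun do rewrite addr0 c0.
have dBX : dB n @[n --> \oo] --> X.
  have := cvg_comp _ _ hd ((is_derive1P _ _ _).1 (is_derive_expmx X)).
  by rewrite /comp; under eq_fun do rewrite addr0 scale0r expmx0.
pose K := m%:R * (`|t| * (`|X| + 1)).
(* The bound that [mx_norm_subX] gives for the distance between the two powers; it tends to 0 since
   both difference quotients tend to [X]. *)
pose b n := m%:R * `|t| * `|dA n - dB n| * expR K.
have b0 : b n @[n --> \oo] --> (0 : R).
  rewrite (_ : 0 = m%:R * `|t| * `|X - X| * expR K); last first.
    by rewrite subrr normr0 mulr0 mul0r.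
  apply: cvgM; last exact: cvg_cst.
  apply: cvgM; first exact: cvg_cst.
  by apply: cvg_norm; exact: (@cvgB _ ('M[R]_m : normedModType R)).
have pow_cvg : c (h n) ^+ n.+1 @[n --> \oo] --> expmx (t *: X).
  apply/subr_cvg0/norm_cvg0P.
  apply: (@squeeze_cvgr _ _ _ _ (cst 0) b) => //; last exact: cvg_cst.
  near=> n; rewrite normr_ge0 /=.
  have dA1 : `|dA n| <= `|X| + 1.
    rewrite ltW//; near: n.
    by apply: (cvgr_lt _ (cvg_norm dAX)); rewrite ltrDl.
  have dB1 : `|dB n| <= `|X| + 1.
    rewrite ltW//; near: n.
    by apply: (cvgr_lt _ (cvg_norm dBX)); rewrite ltrDl.
  have cE : c (h n) - 1%:M = h n *: dA n by rewrite /dA scalerA divff// scale1r.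
  have eE : expmx (h n *: X) - 1%:M = h n *: dB n.
    by rewrite /dB scalerA divff// scale1r.
  have -> : expmx (t *: X) = expmx (h n *: X) ^+ n.+1.
    by rewrite -expmx_natmul scalerA /h mulrCA divff ?mulr1// pnatr_eq0.
  (* With this choice [n.+1%:R * d] equals [K] for every [n], whence [(1 + d) ^+ n.+1 <= expR K]. *)
  pose d := m%:R * (`|h n| * (`|X| + 1)).
  have nh : n.+1%:R * `|h n| = `|t|.
    by rewrite /h normrM normfV (ger0_norm (ler0n _ _)) mulrCA divff ?mulr1 ?pnatr_eq0.
  apply: (le_trans (@mx_norm_subX _ _ d _ _ _)).
  - by rewrite cE normrZ /d !ler_wpM2l.
  - by rewrite eE normrZ /d !ler_wpM2l.
  have -> : c (h n) - expmx (h n *: X) = h n *: (dA n - dB n).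
    by rewrite scalerBr -cE -eE opprB addrA subrK.
  rewrite normrZ [n.+1%:R * _]mulrCA [n.+1%:R * (_ * _)]mulrA nh /b mulrA.
  rewrite ler_wpM2l ?mulr_ge0//.
  have -> : K = n.+1%:R * d by rewrite /K /d -nh; ring.
  rewrite expRM_natl lerXn2r ?nnegrE ?expR_ge0 ?expR_ge1Dx//.
  by rewrite addr_ge0// /d !mulr_ge0// addr_ge0.
move=> N /pow_cvg HN.
have HN' : \forall n \near \oo, N (c (h n) ^+ n.+1) by exact: HN.
have HG : \forall n \near \oo, G (c (h n)) by exact: (hcvg _ Gc).
near \oo => n; exists (c (h n) ^+ n.+1); split; last exact: (near HN' n).
by apply: GX; exact: (near HG n).
Unshelve. all: by end_near. Qed.

End ExpmxCurves.

(** * Derivatives along curves and on subsets *)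

Section Curves.
Context {R : realType}.

Lemma is_derive_cvg (V : normedModType R) (f : R -> V) (a : R) v :
  is_derive a 1 f v -> f @ a --> f a.
Proof.
by case=> /derivable1_diffP df _; exact: differentiable_continuous.
Qed.

Lemma is_derive_pair (V W : normedModType R) (f : R -> V) (h : R -> W)
    (a : R) v w : is_derive a 1 f v -> is_derive a 1 h w ->
  is_derive a 1 (fun e => (f e, h e)) (v, w).
Proof.
move=> /is_derive1P fv /is_derive1P hw; apply/is_derive1P.
exact: (cvg_pair fv hw).
Qed.

Lemma is_derive_mulmx (m n p : nat) (A : R -> 'M[R]_(m, n))
    (B : R -> 'M[R]_(n, p)) (a : R) A' B' :
  is_derive a 1 A A' -> is_derive a 1 B B' ->
  is_derive a 1 (fun e => A e *m B e) (A' *m B a + A a *m B').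
Proof.
move=> dA dB; apply/is_derive1P.
have Ba : B (h + a) @[h --> 0^'] --> B a.
  have sa : (h + a) @[h --> (0 : R)^'] --> a.
    have H : (h + a) @[h --> (0 : R)] --> 0 + a.
      by apply: cvgD; [exact: cvg_id|exact: cvg_cst].
    rewrite add0r in H; move=> N /H HN.
    have HN' : \forall h \near (0 : R), N (h + a) by exact: HN.
    by rewrite /dnbhs /within /=; apply: filterS HN'.
  exact: (cvg_comp _ _ sa (is_derive_cvg dB)).
have -> : (fun h => h^-1 *: (A (h + a) *m B (h + a) - A a *m B a)) =
    (fun h => (h^-1 *: (A (h + a) - A a)) *m B (h + a) +
              A a *m (h^-1 *: (B (h + a) - B a))).
  apply/funext => h; rewrite -scalemxAl -scalemxAr -scalerDr; congr (_ *: _).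
  by rewrite mulmxBl mulmxBr addrA subrK.
apply: (@cvgD _ ('M[R]_(m, p) : normedModType R)).
  by apply: cvg_mulmx => //; exact/is_derive1P.
by apply: cvg_mulmx; [exact: cvg_cst|exact/is_derive1P].
Qed.

Lemma is_diff_curve (V W : normedModType R) (F L : V -> W) (c : R -> V)
    (a : R) v : is_diff (c a) F L -> is_derive a 1 c v ->
  is_derive a 1 (fun e => F (c e)) (L v).
Proof.
move=> [dF <-] [dc <-]; have dc' := (derivable1_diffP _ _).1 dc.
have dFc : differentiable (F \o c) a by exact: differentiable_comp.
rewrite -/(F \o c); split; first exact/derivable1_diffP.
by rewrite !deriveE//= diff_comp.
Qed.

Lemma mx_linear_continuous (m n : nat) (V : normedModType R)
    (f : {linear 'M[R]_(m, n) -> V}) : continuous f.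
Proof.
apply: bounded_linear_continuous; apply/bounded_funP => r.
exists (\sum_i \sum_j (r * `|f (delta_mx i j)|)) => X Xr.
rewrite {1}(matrix_sum_delta X) linear_sum.
apply: (le_trans (ler_norm_sum _ _ _)); apply: ler_sum => i _.
rewrite linear_sum; apply: (le_trans (ler_norm_sum _ _ _)).
apply: ler_sum => j _; rewrite linearZ/= normrZ ler_wpM2r//.
exact: le_trans (mx_entry_le _ _ _) Xr.
Qed.

Lemma is_diff_mx_linear (m n : nat) (V : normedModType R)
    (f : 'M[R]_(m, n) -> V) a : linear f -> is_diff a f f.
Proof.
move=> lf; pose fM := GRing.isLinear.Build _ _ _ _ f lf.
pose fL : {linear _ -> _} := HB.pack f fM.
have fC : continuous fL by exact: mx_linear_continuous.
by split; [exact: (@linear_differentiable _ _ _ fL)|exact: (@diff_lin _ _ _ fL)].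
Qed.

Lemma TPhiE (m : nat) (q w : 'M[R]_m) : TPhi q w = q *m w.
Proof.
have [_ E] : is_diff (1%:M : 'M[R]_m) (Phi q) (Phi q).
  by apply: is_diff_mx_linear => k A B; rewrite /Phi mulmxDr scalemxAr.
by rewrite /TPhi E.
Qed.

End Curves.

(** * Differentials of maps restricted to a subset *)

Section DiffWithin.
Context {R : realType}.

(* The differential at [a] of the restriction of [f] to [A]: [L] is the
   differential of some local extension, hence only its values on directions
   tangent to [A] are intrinsic. *)
Definition diff_within (V W : normedModType R) (A : set V) (f : V -> W) (a : V)
    (L : V -> W) : Prop :=
  exists2 F, is_diff a F L & \forall x \near a, A x -> F x = f x.

Lemma smooth_on_diff_within (V W : normedModType R) (A : set V) (f : V -> W) a :
  smooth_on A f -> A a -> exists L, diff_within A f a L.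
Proof.
move=> sf /sf[U [F [oU Ua /(_ 1%N)[dF _] FE]]]; exists ('d F a), F.
  exact/differentiableP/dF.
by apply: filterS (open_nbhs_nbhs (conj oU Ua)) => x Ux; exact: FE.
Qed.

Lemma diff_within_linear (V W : normedModType R) (A : set V) (f : V -> W) a L :
  diff_within A f a L -> linear L.
Proof. by move=> [F [_ <-] _]; exact: linearP. Qed.

Lemma diff_within_cvg (V W : normedModType R) (A : set V) (f : V -> W) a L
    (B : set W) : diff_within A f a L -> A a -> nbhs (f a) B ->
  \forall x \near a, A x -> B (f x).
Proof.
move=> [F [dF _] FE] Aa Bfa.
have Fa : F a = f a by exact: (nbhs_singleton FE).
have FB : F @ a --> f a by rewrite -Fa; exact: differentiable_continuous.
have FB' : \forall x \near a, B (F x) by exact: (FB _ Bfa).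
near=> x => Ax; rewrite -(near FE x)//; exact: (near FB' x).
Unshelve. all: by end_near. Qed.

Lemma diff_within_comp (U V W : normedModType R) (A : set U) (B : set V)
    (f : U -> V) (h : V -> W) a L M :
  diff_within A f a L -> diff_within B h (f a) M -> A a ->
  (\forall x \near a, A x -> B (f x)) ->
  diff_within A (h \o f) a (M \o L).
Proof.
move=> dwf [H dH HE] Aa AB; have Hf := diff_within_cvg dwf Aa HE.
case: dwf => F dF FE; have Fa : F a = f a by exact: (nbhs_singleton FE).
exists (H \o F); first by apply: is_diff_comp => //; rewrite Fa.
near=> x => Ax /=; rewrite (near FE x)// (near Hf x)//.
by apply: (near AB x).
Unshelve. all: by end_near. Qed.

(** Along a curve that stays in [A], the extension and [f] coincide, so the derivative does not
    depend on the chosen extension. This is how [L] is related to the intrinsic derivatives of the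
    statement. *)
Lemma diff_within_curve (V W : normedModType R) (A : set V) (f : V -> W) L
    (c : R -> V) (a : R) v :
  diff_within A f (c a) L -> is_derive a 1 c v ->
  (\forall e \near a, A (c e)) -> is_derive a 1 (fun e => f (c e)) (L v).
Proof.
move=> [F dF FE] dc Ac.
apply: near_eq_is_derive (is_diff_curve dF dc).
have FEc : \forall e \near a, A (c e) -> F (c e) = f (c e).
  exact: (is_derive_cvg dc FE).
near=> e; apply: (near FEc e) => //; exact: (near Ac e).
Unshelve. all: by end_near. Qed.

Lemma diff_withinD (V W : normedModType R) (A : set V) (f h : V -> W) a L M :
  diff_within A f a L -> diff_within A h a M ->
  diff_within A (fun x => f x + h x) a (fun x => L x + M x).
Proof.
move=> [F dF FE] [H dH HE]; exists (F + H); first exact: is_diffD.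
by near=> x => Ax /=; rewrite -(near FE x)// -(near HE x).
Unshelve. all: by end_near. Qed.

Lemma diff_withinT (V W : normedModType R) (f : V -> W) a L :
  diff_within setT f a L -> is_diff a f L.
Proof.
move=> [F [dF FL] FE]; have Fa : F a = f a by exact: (nbhs_singleton FE).
rewrite -FL.
have FE0 : \forall y \near (0 : V), F (y + a) = f (y + a).
  have sa : (y + a) @[y --> (0 : V)] --> a.
    have H : (y + a) @[y --> (0 : V)] --> 0 + a.
      by apply: cvgD; [exact: cvg_id|exact: cvg_cst].
    by rewrite add0r in H.
  have : \forall y \near (0 : V), [set: V] (y + a) -> F (y + a) = f (y + a).
    exact: (sa _ FE).
  by apply: filterS => y; apply.
have E : f \o shift a = cst (f a) + 'd F a +o_ (0 : V) id.
  have := diff_locally dF; rewrite Fa => H.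
  apply/eqaddoP => e e0; have /eqaddoP/(_ e e0) := H.
  by apply: filter_app; near=> y; rewrite /= !fctE /= (near FE0 y).
have U := diff_unique (diff_continuous dF) E.
by split=> //; apply/diff_locallyP; rewrite U; split => //; exact: diff_continuous.
Unshelve. all: by end_near. Qed.

Lemma is_diff_diff_within (V W : normedModType R) (A : set V) (f : V -> W) a L :
  is_diff a f L -> diff_within A f a L.
Proof. by move=> df; exists f => //; exact: nearW. Qed.

Lemma diff_within_mx_linear (m n : nat) (V W : normedModType R) (A : set V)
    (f : V -> 'M[R]_(m, n)) (h : 'M[R]_(m, n) -> W) a L :
  linear h -> diff_within A f a L -> A a -> diff_within A (h \o f) a (h \o L).
Proof.
move=> lh df Aa; apply: (@diff_within_comp _ _ _ A setT) => //; last by apply: nearW.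
exact/is_diff_diff_within/is_diff_mx_linear.
Qed.

End DiffWithin.

(** * A theorem of the alternative *)

Section Alternative.
Context {R : realType} {V : lmodType R}.

Let convex (C : set V) := forall a b, C a -> C b ->
  forall t : R, 0 <= t <= 1 -> C (t *: a + (1 - t) *: b).

(** Points with [h c > 0] require [s >= - f c / h c], points with [h c < 0] require
    [s <= f c / - h c]. Every lower bound is below every upper bound, because the segment between
    two such points crosses [h = 0], where [f] is nonnegative; [s] is the supremum of the lower
    bounds. *)
Lemma alternative2 (C : set V) (f h : V -> R) (a0 : V) :
  convex C -> scalar f -> scalar h -> C a0 -> h a0 < 0 ->
  (forall c, C c -> h c < 0 -> 0 <= f c) ->
  exists2 s : R, 0 <= s & forall c, C c -> 0 <= f c + s * h c.
Proof.
move=> cC lf lh Ca0 ha0 fC.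
have lin (k : V -> R) : scalar k -> forall t u a b, k (t *: a + u *: b) = t * k a + u * k b.
  move=> lk t u a b; rewrite lk; congr (_ + _).
  have k0 : k 0 = 0 by have := lk (-1) 0 0; rewrite scaler0 addr0 mulN1r addNr.
  by rewrite -[u *: b]addr0 lk k0 addr0.
have f0 c : C c -> h c = 0 -> 0 <= f c.
  move=> Cc hc; rewrite leNgt; apply/negP => fc.
  have fa := fC _ Ca0 ha0.
  (* Moving from [c] towards [a0] by this fraction gives a point where [f] is [f c / 2], still
     negative, while [h] has become negative: a contradiction with [fC]. *)
  pose e := - f c / (2 * (f a0 - f c)).
  have d0 : 0 < f a0 - f c by lra.
  have eE : e * (f a0 - f c) = - f c / 2 by rewrite /e; field; rewrite gt_eqF.
  have e0 : 0 < e by rewrite /e divr_gt0; lra.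
  have e1 : e <= 1 by rewrite /e ler_pdivrMr; lra.
  have e01 : 0 <= e <= 1 by rewrite (ltW e0).
  have := fC _ (cC _ _ Ca0 Cc _ e01).
  rewrite !lin// hc mulr0 addr0 pmulr_rlt0// => /(_ ha0).
  have -> : e * f a0 + (1 - e) * f c = e * (f a0 - f c) + f c by ring.
  by rewrite eE; lra.
have key a b : C a -> C b -> h a < 0 -> 0 < h b -> - f b / h b <= f a / - h a.
  move=> Ca Cb ha hb.
  (* The weight for which [h] vanishes at [t *: a + (1 - t) *: b]. *)
  pose t := h b / (h b - h a).
  have d0 : 0 < h b - h a by lra.
  have t01 : 0 <= t <= 1.
    by rewrite /t divr_ge0 ?(ltW hb) ?(ltW d0)//= ler_pdivrMr//; lra.
  have tE : t * (h b - h a) = h b by rewrite /t divfK ?gt_eqF.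
  have := f0 _ (cC _ _ Ca Cb _ t01).
  rewrite !lin// => fp.
  have hp : t * h a + (1 - t) * h b = 0.
    by transitivity (h b - t * (h b - h a)); [ring|rewrite tE subrr].
  move/(_ hp) : fp => fp.
  have : 0 <= (t * f a + (1 - t) * f b) * (h b - h a) by rewrite mulr_ge0// ltW.
  have -> : (t * f a + (1 - t) * f b) * (h b - h a) =
      t * (h b - h a) * (f a - f b) + f b * (h b - h a) by ring.
  rewrite tE => fp2.
  rewrite ler_pdivrMr// mulrAC ler_pdivlMr; last by lra.
  by nra.
(* Adding 0 to the lower bounds makes the set nonempty and its supremum nonnegative. *)
pose S : set R := [set x | x = 0 \/ exists c, [/\ C c, 0 < h c & x = - f c / h c]].
have Sub a : C a -> h a < 0 -> ubound S (f a / - h a).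
  move=> Ca ha x [->|[c [Cc hc ->]]]; last exact: key.
  by rewrite divr_ge0 ?fC// lerNr oppr0 ltW.
have Ss : has_sup S.
  by split; [exists 0; left|exists (f a0 / - h a0); exact: Sub].
exists (sup S); first by apply: ub_le_sup; [exact: Ss.2|left].
move=> c Cc; have [hc|hc|hc] := ltgtP (h c) 0; last by rewrite hc mulr0 addr0 f0.
- have : sup S <= f c / - h c by apply: ge_sup; [exact: Ss.1|exact: Sub].
  by rewrite ler_pdivlMr; lra.
- have : - f c / h c <= sup S.
    by apply: ub_le_sup; [exact: Ss.2|right; exists c].
  by rewrite ler_pdivrMr//; lra.
Qed.

(** Induction with [C] varying. If the last form is never negative on [C], it alone gets weight 1.
    Otherwise the induction hypothesis on the convex subset where it is negative yields a
    combination of the other forms, and [alternative2] extends that inequality to [C] by a multiple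
    of the last form. The weights already found are kept, so one stays positive. *)
Lemma alternative (n : nat) (C : set V) (f : nat -> V -> R) :
  convex C -> (forall i, scalar (f i)) ->
  (forall c, C c -> exists2 i, (i < n.+1)%N & 0 <= f i c) ->
  exists l : nat -> R, [/\ forall i, 0 <= l i,
    exists2 i, (i < n.+1)%N & 0 < l i &
    forall c, C c -> 0 <= \sum_(i < n.+1) l i * f i c].
Proof.
move=> + lf; elim: n C => [|n IH] C cC fC.
  exists (fun=> 1); split => // [|c /fC[]]; first by exists 0%N.
  by case=> // _ fc; rewrite big_ord1 mul1r.
have [[a0 [Ca0 fa0]]|noC] := pselect (exists a, C a /\ f n.+1 a < 0); last first.
  exists (fun i => (i == n.+1)%:R); split => [i|//|c Cc].
  - by rewrite ler0n.
  - by exists n.+1; rewrite ?eqxx.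
  rewrite big_ord_recr/= eqxx mul1r big1 => [|i _]; last first.
    by rewrite (ltn_eqF (ltn_ord i)) mul0r.
  by rewrite add0r leNgt; apply/negP => fc; apply: noC; exists c.
have cC1 : convex [set c | C c /\ f n.+1 c < 0].
  move=> a b [Ca fa] [Cb fb] t /andP[t0 t1]; split; first by apply: cC; rewrite ?t0.
  have f0 : f n.+1 0 = 0.
    by have := lf n.+1 (-1) 0 0; rewrite scaler0 addr0 mulN1r addNr.
  rewrite lf -[_ *: b]addr0 lf f0 addr0.
  by have [|] := ltP t 1; nra.
have [|l [l0 [i0 i0n li0] lC]] := IH [set c | C c /\ f n.+1 c < 0] cC1.
  move=> c [/fC[i + fic] fc]; rewrite ltnS leq_eqVlt => /orP[/eqP ii|]; last by exists i.
  by move: fc; rewrite -ii ltNge fic.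
have [|s s0 sC] := @alternative2 C (fun c => \sum_(i < n.+1) l i * f i c) (f n.+1)
    a0 cC _ (lf _) Ca0 fa0 (fun c Cc fc => lC c (conj Cc fc)).
  move=> k a b; rewrite mulr_sumr -big_split/=; apply: eq_bigr => i _.
  by rewrite lf; ring.
exists (fun i => if (i < n.+1)%N then l i else s); split => [i||c Cc].
- by case: ifP.
- by exists i0; rewrite ?i0n// ltnS ltnW.
rewrite big_ord_recr/= ltnn.
by under eq_bigr => i _ do rewrite ltn_ord; exact: sC.
Qed.

End Alternative.

(** The version used for optimization: [A] will consist of the cost and the active constraints, and
    the vanishing of the weights outside [A] becomes complementary slackness. *)
Lemma alternative_fin (R : realType) (V : lmodType R) (T : finType) (A : {pred T})
    (t0 : T) (C : set V) (f : T -> V -> R) : t0 \in A ->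
  (forall a b, C a -> C b -> forall t : R, 0 <= t <= 1 -> C (t *: a + (1 - t) *: b)) ->
  (forall t, scalar (f t)) ->
  (forall c, C c -> exists2 t, t \in A & 0 <= f t c) ->
  exists l : T -> R, [/\ forall t, 0 <= l t, forall t, t \notin A -> l t = 0,
    exists t, 0 < l t & forall c, C c -> 0 <= \sum_t l t * f t c].
Proof.
move=> At0 cC lf fC.
have eA : (0 < size (enum A))%N by rewrite -cardE; apply/card_gt0P; exists t0.
pose n := (size (enum A)).-1.
have nE : n.+1 = size (enum A) by rewrite prednK.
have [c Cc|l [l0 [i ileq li] lC]] :=
    alternative (n := n) (f := fun i => f (nth t0 (enum A) i)) cC (fun i => lf _).
  have [t At ft] := fC c Cc; exists (index t (enum A)).
    by rewrite nE index_mem mem_enum.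
  by rewrite nth_index// mem_enum.
exists (fun t => if t \in A then l (index t (enum A)) else 0); split.
- by move=> t; case: ifP.
- by move=> t /negbTE ->.
- exists (nth t0 (enum A) i); rewrite -mem_enum mem_nth -?nE// index_uniq -?nE//.
  exact: enum_uniq.
move=> c Cc; have := lC c Cc.
have -> : \sum_(j < n.+1) l j * f (nth t0 (enum A) j) c =
    \sum_(0 <= j < size (enum A)) l j * f (nth t0 (enum A) j) c.
  by rewrite -nE big_mkord.
have -> : \sum_(0 <= j < size (enum A)) l j * f (nth t0 (enum A) j) c =
    \sum_(t <- enum A) l (index t (enum A)) * f t c.
  rewrite [RHS](big_nth t0) [LHS]big_nat_cond [RHS]big_nat_cond.
  apply: eq_bigr => j; rewrite andbT => /andP[_ jn].
  by rewrite index_uniq// enum_uniq.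
have -> : \sum_t (if t \in A then l (index t (enum A)) else 0) * f t c =
    \sum_(t in A) l (index t (enum A)) * f t c.
  rewrite [RHS]big_mkcond/=; apply: eq_bigr => t _.
  by case: ifP => //; rewrite mul0r.
by rewrite big_enum.
Qed.

(** * Tangent vectors and the logarithm chart *)

Lemma is_derive_affine (R : realType) (V : normedModType R) (a b : V) (t : R) :
  is_derive t 1 (fun e : R => a + e *: b) b.
Proof.
apply/is_derive1P; apply: cvg_near_cst; near=> h.
have h0 : h != 0 by near: h; exact: nbhs_dnbhs_neq.
by rewrite opprD addrACA subrr add0r -scalerBl addrK scalerA mulVf// scale1r.
Unshelve. all: by end_near. Qed.

Lemma near0W (R : realType) (A : R -> Prop) :
  (forall e, A e) -> \forall e \near (0 : R), A e.
Proof.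
move=> AT; near=> e; exact: AT.
Unshelve. all: by end_near. Qed.

(** The forms reading single matrix entries already separate points. This gives the uniqueness
    behind the [xget] in [Ddual]. *)
Lemma subvs_separated (R : realType) (m : nat) (g : {vspace 'M[R]_m})
    (Y Z : subvs_of g) : (forall d : dualv g, d Y = d Z) -> Y = Z.
Proof.
move=> dYZ; apply: val_inj; apply/matrixP => i j.
pose e (W : subvs_of g) : R^o := vsval W i j.
have le : linear e by move=> k A B; rewrite /e linearP !mxE.
pose eL : {linear subvs_of g -> R^o} :=
  HB.pack e (GRing.isLinear.Build _ _ _ _ e le).
by have := dYZ (linfun eL); rewrite !lfunE.
Qed.

Section LieCalculus.
Context {R : realType} {m : nat} {G : set 'M[R]_m} {g : {vspace 'M[R]_m}}.
Hypotheses (lieG : matrix_lie_group G) (lie_g : lie_algebra_of G g).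
Implicit Types (q s w : 'M[R]_m).

Lemma lie_unit q : G q -> q \in unitmx.
Proof. by case: lieG => + _ _ _ _; apply. Qed.

Lemma lie_mul q s : G q -> G s -> G (q *m s).
Proof. by case: lieG => _ _ + _ _; apply. Qed.

Lemma lie_inv q : G q -> G (invmx q).
Proof. by case: lieG => _ _ _ + _; apply. Qed.

Lemma lie_exp q w (e : R) : G q -> w \in g -> G (q *m expmx (e *: w)).
Proof. by move=> Gq /lie_g gw; exact: lie_mul. Qed.

Lemma lie_tangent c q v : G q -> c 0 = q -> is_derive (0 : R) 1 c v ->
  (\forall e \near (0 : R), G (c e)) -> invmx q *m v \in g.
Proof.
move=> Gq cq dc Gc; apply/lie_g.
apply: (@lie_group_velocity _ _ G (fun e => invmx q *m c e)) => //.
- by rewrite cq mulVmx// lie_unit.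
- have := is_derive_mulmx (is_derive_cst (invmx q) (0 : R) 1) dc.
  by rewrite mul0mx add0r.
- by apply: filterS Gc => e Gce; apply: lie_mul => //; exact: lie_inv.
Qed.

Lemma is_derive_exp_curve q w :
  is_derive (0 : R) 1 (fun e => q *m expmx (e *: w)) (q *m w).
Proof.
have := is_derive_mulmx (is_derive_cst q (0 : R) 1) (is_derive_expmx w).
by rewrite mul0mx add0r.
Qed.

Lemma DG_val (W : normedModType R) (F : 'M[R]_m -> W) q w v : q \in unitmx ->
  is_derive (0 : R) 1 (fun e => F (q *m expmx (e *: w))) v ->
  DG F q (q *m w) = v.
Proof.
move=> uq [_ <-]; rewrite /DG -derive1E.
by under eq_fun do rewrite mulKmx//.
Qed.

(** The conjugated exponential curve lies in [G] and passes through the identity, so its velocity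
    lies in [g] and the projection in [Ad] leaves it unchanged. *)
Lemma Ad_val s (b : subvs_of g) : G s ->
  vsval (Ad s b) = s *m vsval b *m invmx s.
Proof.
move=> Gs; have us := lie_unit Gs.
have dc : is_derive (0 : R) 1 (fun r : R => s *m expmx (r *: vsval b) *m invmx s)
    (s *m vsval b *m invmx s).
  have := is_derive_mulmx (is_derive_exp_curve s (vsval b))
    (is_derive_cst (invmx s) (0 : R) 1).
  by rewrite mulmx0 addr0.
rewrite /Ad derive1E; case: (dc) => _ ->; rewrite vsprojK//.
have G1 : G 1%:M by case: lieG.
have Gc : \forall e \near (0 : R), G (s *m expmx (e *: vsval b) *m invmx s).
  apply: near0W => e; apply: lie_mul; last exact: lie_inv.
  by apply: lie_exp => //; exact: subvsP.
rewrite -[X in X \in g]mul1mx -(invmx1 _ m).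
by apply: (lie_tangent G1 _ dc Gc); rewrite scale0r expmx0 mulmx1 mulmxV.
Qed.

Section Chart.
Context {O : set 'M[R]_m}.
Hypotheses (Og : open_in [set` g] O) (expO : open_in G (@expmx R m @` O))
  (diffO : diffeo_on O (@expmx R m @` O) (@expmx R m)).

Lemma chart_sub X : O X -> X \in g.
Proof. by case: Og => U _ -> []. Qed.

Lemma logmxK s : (@expmx R m @` O) s -> expmx (logmx O s) = s.
Proof. by move=> Es; rewrite /logmx pinvK// inE. Qed.

Lemma expmxK X : O X -> logmx O (expmx X) = X.
Proof.
move=> OX; case: diffO => -[_ inj _] _ _.
by rewrite /logmx pinvKV// inE.
Qed.

Lemma logmx_in s : (@expmx R m @` O) s -> O (logmx O s).
Proof. by case=> X OX <-; rewrite expmxK. Qed.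

Lemma near_chart s : (@expmx R m @` O) s ->
  \forall x \near s, G x -> (@expmx R m @` O) x.
Proof.
case: expO => U oU -> [Gs Us].
by apply: filterS (open_nbhs_nbhs (conj oU Us)) => x Ux Gx; split.
Qed.

Lemma chart_lie s : (@expmx R m @` O) s -> G s.
Proof. by case: expO => U oU -> []. Qed.

Section LogDerivative.
Context {s : 'M[R]_m} {L : 'M[R]_m -> 'M[R]_m}.
Hypotheses (Es : (@expmx R m @` O) s)
  (dL : diff_within (@expmx R m @` O) (logmx O) s L).

(** The image of the chart is open in [G], so a curve in [G] through [s] stays in it for a short
    time and its logarithm is a curve in [g]. *)
Lemma is_derive_logmx c v : c 0 = s -> is_derive (0 : R) 1 c v ->
  (\forall e \near (0 : R), G (c e)) ->
  [/\ \forall e \near (0 : R), (@expmx R m @` O) (c e),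
      is_derive (0 : R) 1 (fun e => logmx O (c e)) (L v) & L v \in g].
Proof.
move=> cs dc Gc.
have Ec : \forall e \near (0 : R), (@expmx R m @` O) (c e).
  have cc : c @ (0 : R) --> s by rewrite -cs; exact: is_derive_cvg dc.
  have H : \forall e \near (0 : R), G (c e) -> (@expmx R m @` O) (c e).
    exact: (cc _ (near_chart Es)).
  by near=> e; apply: (near H e) => //; exact: (near Gc e).
have dl : is_derive (0 : R) 1 (fun e => logmx O (c e)) (L v).
  by apply: (diff_within_curve _ dc Ec); rewrite cs.
split=> //.
(* The linear map [p] vanishes on [g], hence along the logarithm of the curve; so it also kills the
   derivative [L v], which is therefore equal to its own projection on [g]. *)
pose p X : 'M[R]_m := X - projv g X.
have lp : linear p by move=> k A B; rewrite /p linearP scalerBr opprD addrACA.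
have dp := is_diff_curve (is_diff_mx_linear (logmx O (c 0)) lp) dl.
have dp0 : is_derive (0 : R) 1 (fun e => p (logmx O (c e))) 0.
  apply: (near_eq_is_derive _ (is_derive_cst 0 (0 : R) 1)).
  near=> e; rewrite /p projv_id ?subrr// chart_sub//; apply: logmx_in.
  exact: (near Ec e).
have : p (L v) = 0 by case: dp => _ <-; case: dp0.
by move=> /eqP; rewrite subr_eq0 => /eqP ->; exact: memv_proj.
Unshelve. all: by end_near. Qed.

Lemma diff_logmx_in w : w \in g -> L (s *m w) \in g.
Proof.
move=> gw; case: (@is_derive_logmx (fun e => s *m expmx (e *: w)) (s *m w)) => //.
- by rewrite scale0r expmx0 mulmx1.
- exact: is_derive_exp_curve.
- by apply: near0W => e; apply: lie_exp => //; exact: chart_lie.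
Qed.

Lemma DlogStarE (zeta : dualv g) (w : subvs_of g) :
  DlogStar O s zeta w = zeta (vsproj g (L (s *m vsval w))).
Proof.
rewrite /DlogStar TPhiE; congr (zeta (vsproj _ _)).
have Gs := chart_lie Es; apply: DG_val; first exact: lie_unit.
case: (@is_derive_logmx (fun e => s *m expmx (e *: vsval w)) (s *m vsval w)) => //.
- by rewrite scale0r expmx0 mulmx1.
- exact: is_derive_exp_curve.
- by apply: near0W => e; apply: lie_exp => //; exact: subvsP.
Qed.

(* [exp] is a left inverse of [log] along [s exp(e w)]. *)
Lemma diff_logmx_inj w : w \in g -> L (s *m w) = 0 -> w = 0.
Proof.
move=> gw Lw; have Gs := chart_lie Es.
pose c (e : R) := s *m expmx (e *: w).
have c0 : c 0 = s by rewrite /c scale0r expmx0 mulmx1.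
have dc : is_derive (0 : R) 1 c (s *m w) by exact: is_derive_exp_curve.
have Gc : \forall e \near (0 : R), G (c e) by apply: near0W => e; exact: lie_exp.
have [Ec dl _] := is_derive_logmx c0 dc Gc.
case: diffO => _ /smooth_on_diff_within sO _.
have [M dM] := sO _ (logmx_in Es).
have lM := diff_within_linear dM.
have de : is_derive (0 : R) 1 (fun e => expmx (logmx O (c e))) (M (L (s *m w))).
  apply: (@diff_within_curve _ _ _ O) dl _; first by rewrite c0.
  by apply: filterS Ec => e; exact: logmx_in.
have : M (L (s *m w)) = s *m w.
  case: de => _ <-; case: dc => _ <-; apply: near_eq_derive.
  by apply: filterS Ec => e; exact: logmxK.
have -> : M (L (s *m w)) = 0.
  by rewrite Lw; have := lM (-1) 0 0; rewrite scaler0 addr0 scaleN1r addNr.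
by move=> sw; rewrite -[w](mulKmx (lie_unit Gs)) -sw mulmx0.
Qed.

(** The map [T] below is an injective endomorphism of the finite-dimensional space [g], hence
    invertible, and [r] composed with its inverse is a preimage. This makes the adjoint equation for
    [rho] solvable for the earlier [zeta]. *)
Lemma DlogStar_surj (r : dualv g) :
  exists zeta : dualv g, forall v, DlogStar O s zeta v = r v.
Proof.
have lL := diff_within_linear dL.
pose T (w : subvs_of g) : subvs_of g := vsproj g (L (s *m vsval w)).
have lT : linear T.
  move=> k A B; rewrite /T.
  have -> : vsval (k *: A + B) = k *: vsval A + vsval B by exact: linearP.
  by rewrite mulmxDr -scalemxAr lL linearP.
pose TL : {linear subvs_of g -> subvs_of g} :=
  HB.pack T (GRing.isLinear.Build _ _ _ _ T lT).
have kT : lker (linfun TL) == 0%VS.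
  apply/lker0P => A B; rewrite !lfunE/= => TAB.
  have : T (A - B) = 0.
    by rewrite -[A - B]addrC -scaleN1r lT scaleN1r TAB addNr.
  move=> /(congr1 vsval); rewrite /T vsprojK ?diff_logmx_in ?subvsP// raddf0.
  move=> /(diff_logmx_inj (subvsP _)) /eqP.
  by rewrite linearB subr_eq0 => /eqP/val_inj.
exists (r \o (linfun TL)^-1)%VF => w.
rewrite DlogStarE comp_lfunE/=; congr (r _).
by rewrite -/(T w) -[T w]/(TL w) -[TL w]lfunE lker0_lfunK.
Qed.

End LogDerivative.
End Chart.
End LieCalculus.

(** * Derivatives of the Hamiltonian *)

Section PartialDerivatives.
Context {R : realType}.

Lemma is_diff_fst (V W : normedModType R) (p : V * W) : is_diff p fst fst.
Proof.
have C : continuous (fst : V * W -> V) by move=> ?; exact: cvg_fst.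
by split; [exact: linear_differentiable|exact: diff_lin].
Qed.

Lemma diff_withinZ (V W : normedModType R) (A : set V) (f : V -> W) a L (k : R) :
  diff_within A f a L -> diff_within A (fun x => k *: f x) a (fun x => k *: L x).
Proof.
move=> [F dF FE]; exists (k *: F); first exact: is_diffZ.
by near=> x => Ax /=; rewrite -(near FE x).
Unshelve. all: by end_near. Qed.

Lemma Drow_within (V : normedModType R) (n : nat) (A : set V) (f : V -> R) L
    (i di : 'cV[R]_n -> V) x v :
  diff_within A (f : V -> R^o) (i x) L -> is_diff x i di -> (forall y, A (i y)) ->
  (Drow (fun y => f (i y)) x *m v) 0 0 = L (di v).
Proof.
move=> dF di' Ai.
have /diff_withinT[_ E] : diff_within setT ((f : V -> R^o) \o i) x (L \o di).
  apply: (diff_within_comp (is_diff_diff_within setT di') dF) => //.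
  by near=> y => _; exact: Ai.
rewrite mxE -[RHS]/((L \o di) v) -E {2}(matrix_sum_delta v).
rewrite linear_sum; apply: eq_bigr => j _.
by rewrite linear_sum big_ord1 linearZ/= !mxE mulrC.
Unshelve. all: by end_near. Qed.

Lemma Dcol_affine (n : nat) (phi : 'rV[R]_n -> R) xi (f : 'cV[R]_n) k :
  (forall y, phi y = k + (y *m f) 0 0) -> Dcol phi xi = f.
Proof.
move=> phiE; have lf : linear (fun y : 'rV[R]_n => (y *m f) 0 0 : R^o).
  by move=> c a b; rewrite mulmxDl -scalemxAl !mxE.
have [_ E] : is_diff xi (phi : 'rV[R]_n -> R^o) (fun y => (y *m f) 0 0 : R^o).
  have -> : phi = (cst k : 'rV[R]_n -> R^o) + (fun y => (y *m f) 0 0 : R^o).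
    by apply/funext => y; rewrite phiE.
  apply: is_diff_eq (is_diffD (is_diff_cst _ _) (is_diff_mx_linear xi lf)) _.
  by rewrite add0r.
apply/matrixP => i j; rewrite mxE E ord1 -rowE mxE.
by [].
Qed.

End PartialDerivatives.

Lemma DG_within (R : realType) (m : nat) (G : set 'M[R]_m)
    (g : {vspace 'M[R]_m}) (V W : normedModType R) (A : set V) (f : V -> W) L
    (i : 'M[R]_m -> V) q w v :
  matrix_lie_group G -> lie_algebra_of G g -> G q -> w \in g ->
  diff_within A f (i q) L ->
  is_derive (0 : R) 1 (fun e => i (q *m expmx (e *: w))) v ->
  (forall h, G h -> A (i h)) -> DG (fun h => f (i h)) q (q *m w) = L v.
Proof.
move=> lieG lie_g Gq gw df di Ai; apply: DG_val; first exact: (lie_unit lieG).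
have df0 : diff_within A f (i (q *m expmx ((0 : R) *: w))) L.
  by rewrite scale0r expmx0 mulmx1.
apply: (diff_within_curve df0 di).
by apply: near0W => e; apply: Ai; exact: (lie_exp lieG lie_g).
Qed.

Section HamiltonianDerivatives.
Context {R : realType} {m nx nu : nat} {P : ocp R m nx nu} {G : set 'M[R]_m}
  {g : {vspace 'M[R]_m}} {O : set 'M[R]_m}.
Hypotheses (lieG : matrix_lie_group G) (lie_g : lie_algebra_of G g)
  (Og : open_in [set` g] O) (expO : open_in G (@expmx R m @` O))
  (diffO : diffeo_on O (@expmx R m @` O) (@expmx R m)).
Context {t : nat} {q : 'M[R]_m} {x : 'cV[R]_nx} {u : 'cV[R]_nu}.
Implicit Types (w : 'M[R]_m) (y : 'cV[R]_nx) (v : 'cV[R]_nu).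

Let dq w : w \in g ->
  is_derive (0 : R) 1 (fun e => (q *m expmx (e *: w), x)) (q *m w, 0).
Proof.
move=> _; have A := is_derive_exp_curve q w.
have B := is_derive_cst x (0 : R) 1.
exact: is_derive_pair A B.
Qed.

Section Constraint.
Context {L : 'M[R]_m * 'cV[R]_nx -> 'cV[R]_(ncstr P t)}.
Hypotheses (Gq : G q) (dL : diff_within [set p : 'M[R]_m * 'cV[R]_nx | G p.1]
  (fun p => cstr P t p.1 p.2) (q, x) L).
Context {mu : 'rV[R]_(ncstr P t)}.

Let dLj j : diff_within [set p : 'M[R]_m * 'cV[R]_nx | G p.1]
  (fun p => cstr P t p.1 p.2 j 0 : R^o) (q, x) (fun p => L p j 0).
Proof.
have lj : linear (fun X : 'cV[R]_(ncstr P t) => X j 0 : R^o).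
  by move=> k a b; rewrite !mxE.
exact: (diff_within_mx_linear lj dL Gq).
Qed.

Lemma muDqgE w : w \in g -> muDqg mu q x (q *m w) = (mu *m L (q *m w, 0)) 0 0.
Proof.
move=> gw; rewrite mxE; apply: eq_bigr => j _; congr (_ * _).
exact: (DG_within (i := fun h => (h, x)) lieG lie_g Gq gw (dLj j) (dq gw)).
Qed.

Lemma muDxgE y : (muDxg mu q x *m y) 0 0 = (mu *m L (0, y)) 0 0.
Proof.
rewrite /muDxg mulmx_suml summxE mxE; apply: eq_bigr => j _.
rewrite -scalemxAl mxE; congr (_ * _).
exact: (Drow_within y (dLj j) (is_diff_pair (is_diff_cst q x) (is_diff_id x))).
Qed.

End Constraint.

Section EndCost.
Context {L : 'M[R]_m * 'cV[R]_nx -> R^o}.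
Hypotheses (Gq : G q) (dL : diff_within [set p : 'M[R]_m * 'cV[R]_nx | G p.1]
  (fun p => cost_end P p.1 p.2 : R^o) (q, x) L).

Lemma DqcendE w : w \in g -> Dqcend P q x (q *m w) = L (q *m w, 0).
Proof.
move=> gw; exact: (DG_within (i := fun h => (h, x)) lieG lie_g Gq gw dL (dq gw)).
Qed.

Lemma DxcendE y : (Dxcend P q x *m y) 0 0 = L (0, y).
Proof.
exact: (Drow_within y dL (is_diff_pair (is_diff_cst q x) (is_diff_id x))).
Qed.

End EndCost.

Section Ham.
Context {nu_ : R} {zeta : dualv g} {xi : 'rV[R]_nx}.

Lemma DzetaHE :
  DzetaH P O nu_ t zeta xi q x u = vsproj g (logmx O (gstep P t q x)).
Proof.
set Z := vsproj g _.
have dZ (d : dualv g) : is_derive (0 : R) (1 : R)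
    ((fun e : R => Ham P O nu_ t (zeta + e *: d) xi q x u) : R -> R^o) (d Z).
  have := is_derive_affine (Ham P O nu_ t zeta xi q x u : R^o) (d Z) 0.
  apply: near_eq_is_derive; apply: near0W => e.
  rewrite /Ham -/Z add_lfunE scale_lfunE /GRing.scale/=; ring.
apply: xget_unique => // Y dY; apply: subvs_separated => d.
by case: (dY d) => _ <-; case: (dZ d).
Qed.

Lemma DxiHE : DxiH P O nu_ t zeta xi q x u = dyn P t q x u.
Proof. by apply: Dcol_affine => y; rewrite /Ham. Qed.

Context {LS : 'M[R]_m * 'cV[R]_nx -> 'M[R]_m}
  {LF : 'M[R]_m * 'cV[R]_nx * 'cV[R]_nu -> 'cV[R]_nx}
  {LC : 'M[R]_m * 'cV[R]_nx * 'cV[R]_nu -> R^o} {LL : 'M[R]_m -> 'M[R]_m}.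
Hypotheses (Gq : G q) (Gstep : forall q' x', G q' -> G (gstep P t q' x'))
  (Es : (@expmx R m @` O) (gstep P t q x))
  (dS : diff_within [set p : 'M[R]_m * 'cV[R]_nx | G p.1]
     (fun p => gstep P t p.1 p.2) (q, x) LS)
  (dF : diff_within [set p : 'M[R]_m * 'cV[R]_nx * 'cV[R]_nu | G p.1.1]
     (fun p => dyn P t p.1.1 p.1.2 p.2) (q, x, u) LF)
  (dC : diff_within [set p : 'M[R]_m * 'cV[R]_nx * 'cV[R]_nu | G p.1.1]
     (fun p => cost P t p.1.1 p.1.2 p.2 : R^o) (q, x, u) LC)
  (dL : diff_within (@expmx R m @` O) (logmx O) (gstep P t q x) LL).

(** The differential of the Hamiltonian jointly in [(q, x, u)]; the partial derivatives of the
    statement are its values on the three factors. *)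
Definition dHam (p : 'M[R]_m * 'cV[R]_nx * 'cV[R]_nu) : R^o :=
  nu_ *: LC p + zeta (vsproj g (LL (LS p.1))) + (xi *m LF p) 0 0.

Lemma Ham_diff_within :
  diff_within [set p : 'M[R]_m * 'cV[R]_nx * 'cV[R]_nu | G p.1.1]
    (fun p => Ham P O nu_ t zeta xi p.1.1 p.1.2 p.2 : R^o) (q, x, u) dHam.
Proof.
apply: diff_withinD; last first.
  have lxi : linear (fun X : 'cV[R]_nx => (xi *m X) 0 0 : R^o).
    by move=> k a b; rewrite mulmxDr -scalemxAr !mxE.
  exact: (diff_within_mx_linear lxi dF Gq).
apply: diff_withinD; first exact: diff_withinZ.
have d1 : diff_within [set p : 'M[R]_m * 'cV[R]_nx * 'cV[R]_nu | G p.1.1]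
    fst (q, x, u) fst by exact/is_diff_diff_within/is_diff_fst.
have d2 := diff_within_comp d1 dS Gq _.
have d3 : diff_within [set p : 'M[R]_m * 'cV[R]_nx * 'cV[R]_nu | G p.1.1]
    (fun p => gstep P t p.1.1 p.1.2) (q, x, u) (LS \o fst).
  by apply: d2; near=> p.
have d4 : diff_within [set p : 'M[R]_m * 'cV[R]_nx * 'cV[R]_nu | G p.1.1]
    (fun p => logmx O (gstep P t p.1.1 p.1.2)) (q, x, u) (LL \o (LS \o fst)).
  apply: (diff_within_comp d3 dL) => //.
  (* The chart image is only a relative neighbourhood in [G]; [Gstep] ensures that nearby steps
     remain in [G], hence in the chart. *)
  have H := diff_within_cvg d3 Gq (near_chart expO Es).
  by near=> p => /= Gp; apply: (near H p) => //; exact: Gstep.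
have lz : linear (fun X => zeta (vsproj g X) : R^o).
  by move=> k a b; rewrite !linearP.
exact: (diff_within_mx_linear lz d4 Gq).
Unshelve. all: by end_near. Qed.

Lemma dHam_linear : linear dHam.
Proof. exact: diff_within_linear Ham_diff_within. Qed.

Lemma DqHE w : w \in g ->
  DqH P O nu_ t zeta xi q x u (q *m w) = dHam (q *m w, 0, 0).
Proof.
move=> gw; have dqu := is_derive_pair (dq gw) (is_derive_cst u (0 : R) 1).
exact: (DG_within (i := fun h => (h, x, u)) lieG lie_g Gq gw Ham_diff_within dqu).
Qed.

Lemma DxHE y : (DxH P O nu_ t zeta xi q x u *m y) 0 0 = dHam (0, y, 0).
Proof.
exact: (Drow_within y Ham_diff_within (is_diff_pair
  (is_diff_pair (is_diff_cst q x) (is_diff_id x)) (is_diff_cst u x))).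
Qed.

Lemma DuHE v : (DuH P O nu_ t zeta xi q x u *m v) 0 0 = dHam (0, 0, v).
Proof.
exact: (Drow_within v Ham_diff_within
  (is_diff_pair (is_diff_cst (q, x) u) (is_diff_id u))).
Qed.

End Ham.
End HamiltonianDerivatives.

(** * One step of the adjoint equation *)

Section AdjointStep.
Context {R : realType} {m nx nu : nat} {P : ocp R m nx nu} {G : set 'M[R]_m}
  {g : {vspace 'M[R]_m}} {O : set 'M[R]_m}.
Hypotheses (lieG : matrix_lie_group G) (lie_g : lie_algebra_of G g)
  (Og : open_in [set` g] O) (expO : open_in G (@expmx R m @` O))
  (diffO : diffeo_on O (@expmx R m @` O) (@expmx R m)).
Context {t : nat} {q : 'M[R]_m} {x : 'cV[R]_nx} {u : 'cV[R]_nu}.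
Context {nu_ : R} {zeta : dualv g} {xi : 'rV[R]_nx}.
Context {LS : 'M[R]_m * 'cV[R]_nx -> 'M[R]_m}
  {LF : 'M[R]_m * 'cV[R]_nx * 'cV[R]_nu -> 'cV[R]_nx}
  {LC : 'M[R]_m * 'cV[R]_nx * 'cV[R]_nu -> R^o} {LL : 'M[R]_m -> 'M[R]_m}.
Hypotheses (Gq : G q) (Gstep : forall q' x', G q' -> G (gstep P t q' x'))
  (Es : (@expmx R m @` O) (gstep P t q x))
  (dS : diff_within [set p : 'M[R]_m * 'cV[R]_nx | G p.1]
     (fun p => gstep P t p.1 p.2) (q, x) LS)
  (dF : diff_within [set p : 'M[R]_m * 'cV[R]_nx * 'cV[R]_nu | G p.1.1]
     (fun p => dyn P t p.1.1 p.1.2 p.2) (q, x, u) LF)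
  (dC : diff_within [set p : 'M[R]_m * 'cV[R]_nx * 'cV[R]_nu | G p.1.1]
     (fun p => cost P t p.1.1 p.1.2 p.2 : R^o) (q, x, u) LC)
  (dL : diff_within (@expmx R m @` O) (logmx O) (gstep P t q x) LL).
Context {LG : 'M[R]_m * 'cV[R]_nx -> 'cV[R]_(ncstr P t)} {mu : 'rV[R]_(ncstr P t)}.
Hypothesis (dG : diff_within [set p : 'M[R]_m * 'cV[R]_nx | G p.1]
  (fun p => cstr P t p.1 p.2) (q, x) LG).

Let s := gstep P t q x.
Let Z := vsval (DzetaH P O nu_ t zeta xi q x u).
Let dH := dHam (nu_ := nu_) (zeta := zeta) (xi := xi) (LS := LS) (LF := LF)
  (LC := LC) (LL := LL).

Lemma exp_DzetaH : expmx Z = s.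
Proof.
rewrite /Z DzetaHE vsprojK ?logmxK//.
by apply: (chart_sub Og); exact: (logmx_in diffO).
Qed.

(** With [s = expmx Z], the adjoint action of the inverse sends [w] to [s^-1 w s], and the left
    translation by [s] in [DlogStar] turns this into the right translate [w s]. *)
Lemma AdStar_DlogStar (w : subvs_of g) :
  AdStar (expmx (- Z)) (DlogStar O (expmx Z) zeta) w =
  zeta (vsproj g (LL (vsval w *m s))).
Proof.
have Gs := chart_lie expO Es; have us := lie_unit lieG Gs.
rewrite -invmx_expmx exp_DzetaH /AdStar.
rewrite (DlogStarE lieG lie_g Og expO diffO Es dL).
rewrite (Ad_val lieG lie_g _ (lie_inv lieG Gs)) invmxK.
by rewrite -!mulmxA mulKVmx.
Qed.

(** The right side of the adjoint equation for [rho], expressed through differentials so that its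
    linearity in [w] can be proved. *)
Definition adjoint_rhs (w : subvs_of g) : R^o :=
  zeta (vsproj g (LL (vsval w *m s))) +
  (dH (q *m vsval w, 0, 0) + (mu *m LG (q *m vsval w, 0)) 0 0).

Lemma adjoint_rhsE (w : subvs_of g) :
  AdStar (expmx (- Z)) (DlogStar O (expmx Z) zeta) w +
  TPhiStar q (DqH P O nu_ t zeta xi q x u \+ muDqg mu q x) w = adjoint_rhs w.
Proof.
rewrite AdStar_DlogStar /TPhiStar TPhiE /=; congr (_ + (_ + _)).
  by rewrite (DqHE lieG lie_g expO Gq Gstep Es dS dF dC dL) ?subvsP.
by rewrite (muDqgE lieG lie_g Gq dG) ?subvsP.
Qed.

Lemma adjoint_rhs_linear : linear adjoint_rhs.
Proof.
have lL := diff_within_linear dL.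
have lG := diff_within_linear dG.
have lH : linear dH := dHam_linear expO Gq Gstep Es dS dF dC dL.
move=> k a b; rewrite /adjoint_rhs.
have -> : vsval (k *: a + b) = k *: vsval a + vsval b by exact: linearP.
rewrite mulmxDl -scalemxAl lL !linearP.
have -> : (k *: (q *m vsval a) + q *m vsval b, 0, 0) =
    k *: (q *m vsval a, 0, 0) + (q *m vsval b, 0, 0) :> 'M[R]_m * 'cV[R]_nx * 'cV[R]_nu.
  by congr (_, _, _); rewrite /= scaler0 addr0.
have -> : (k *: (q *m vsval a) + q *m vsval b, 0) =
    k *: (q *m vsval a, 0) + (q *m vsval b, 0) :> 'M[R]_m * 'cV[R]_nx.
  by congr (_, _); rewrite /= scaler0 addr0.
rewrite lH lG mulmxDr -scalemxAr !mxE.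
have E (a1 a2 b1 b2 c1 c2 : R) : k * a1 + a2 + (k * b1 + b2 + (k * c1 + c2)) =
    k * (a1 + (b1 + c1)) + (a2 + (b2 + c2)) by ring.
exact: E.
Qed.

(* The left side is the pairing of the adjoint variables with the variation of
   the state at time [t + 1]; [h] and [y] are the variations at time [t]. *)
Lemma adjoint_pairing (h : 'M[R]_m) (y : 'cV[R]_nx) (v : 'cV[R]_nu) :
  invmx s *m (h *m s + LS (q *m h, y)) \in g ->
  DlogStar O s zeta (vsproj g (invmx s *m (h *m s + LS (q *m h, y)))) +
  (xi *m LF (q *m h, y, v)) 0 0 =
  zeta (vsproj g (LL (h *m s))) + dH (q *m h, y, v) - nu_ * LC (q *m h, y, v).
Proof.
move=> gh; have Gs := chart_lie expO Es; have us := lie_unit lieG Gs.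
have lL := diff_within_linear dL.
rewrite (DlogStarE lieG lie_g Og expO diffO Es dL) vsprojK// mulKVmx//.
rewrite -[h *m s]scale1r lL !linearP /= !scale1r /dH /dHam /=.
have E (a b c d : R) : a + b + c = a + (d + b + c) - d by ring.
exact: E.
Qed.

Lemma dHam_split (h : 'M[R]_m) (y : 'cV[R]_nx) (v : 'cV[R]_nu) :
  dH (h, y, v) = dH (h, 0, 0) + dH (0, y, 0) + dH (0, 0, v).
Proof.
have lH : linear dH := dHam_linear expO Gq Gstep Es dS dF dC dL.
rewrite -[dH (h, 0, 0)]scale1r -lH -[dH (_ + _)]scale1r -lH !scale1r.
by congr (dH (_, _, _)); rewrite /= ?addr0 ?add0r.
Qed.

End AdjointStep.

(** * Variations of trajectories and multipliers *)

Lemma is_derive_lt0_right (R : realType) (f : R -> R) d :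
  is_derive (0 : R) 1 (f : R -> R^o) d -> d < 0 ->
  \forall e \near (0 : R)^'+, f e < f 0.
Proof.
move=> /is_derive1P df d0.
have H : \forall h \near (0 : R)^', h^-1 *: (f (h + 0) - f 0) < 0 :> R^o.
  exact: (cvgr_lt _ df).
have {}H : \forall h \near (0 : R)^'+, h^-1 * (f (h + 0) - f 0) < 0.
  move: H; rewrite !near_withinE; apply: filterS => h Hh h0.
  by apply: Hh; rewrite gt_eqF.
near=> e; have e0 : 0 < e by [].
have := near H e; rewrite /= => /(_ _); rewrite pmulr_rlt0 ?invr_gt0// addr0 subr_lt0.
by apply.
Unshelve. all: by end_near. Qed.

Section Variation.
Context {R : realType} {m nx nu : nat} {P : ocp R m nx nu} {G : set 'M[R]_m}
  {g : {vspace 'M[R]_m}}.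
Hypotheses (lieG : matrix_lie_group G) (lie_g : lie_algebra_of G g).
Local Notation N := (horizon P).
Hypothesis Gstep : forall t, (t < N)%N -> forall q x, G q -> G (gstep P t q x).
Context {q : nat -> 'M[R]_m} {x : nat -> 'cV[R]_nx} {u : nat -> 'cV[R]_nu}.
Hypothesis adm : admissible P G q x u.
Context {LS : nat -> 'M[R]_m * 'cV[R]_nx -> 'M[R]_m}
  {LF : nat -> 'M[R]_m * 'cV[R]_nx * 'cV[R]_nu -> 'cV[R]_nx}.
Hypotheses
  (dS : forall t, (t < N)%N -> diff_within [set p : 'M[R]_m * 'cV[R]_nx | G p.1]
     (fun p => gstep P t p.1 p.2) (q t, x t) (LS t))
  (dF : forall t, (t < N)%N ->
     diff_within [set p : 'M[R]_m * 'cV[R]_nx * 'cV[R]_nu | G p.1.1]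
     (fun p => dyn P t p.1.1 p.1.2 p.2) (q t, x t, u t) (LF t)).
Implicit Types (v : nat -> 'cV[R]_nu).

(* First-order variation of the state, left-trivialized in [q]. *)
Fixpoint variation v t : 'M[R]_m * 'cV[R]_nx :=
  if t is k.+1 then
    let p := variation v k in let s := gstep P k (q k) (x k) in
    (invmx s *m (p.1 *m s + LS k (q k *m p.1, p.2)), LF k (q k *m p.1, p.2, v k))
  else (0, 0).

Fixpoint trajectory v (e : R) t : 'M[R]_m * 'cV[R]_nx :=
  if t is k.+1 then
    let p := trajectory v e k in
    (p.1 *m gstep P k p.1 p.2, dyn P k p.1 p.2 (u k + e *: v k))
  else (q_init P, x_init P).

Definition velocity v t : 'M[R]_m * 'cV[R]_nx :=
  (q t *m (variation v t).1, (variation v t).2).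

Lemma trajectory_lie v e t : (t <= N)%N -> G (trajectory v e t).1.
Proof.
elim: t => [_|t IH tN] /=.
  by case: adm => /(_ 0%N (leq0n _)) + [<- _] _ _.
have Gt := IH (ltnW tN).
by apply: (lie_mul lieG) => //; exact: Gstep.
Qed.

Lemma trajectory0 v t : (t <= N)%N -> trajectory v 0 t = (q t, x t).
Proof.
case: adm => _ [q0 x0] dynE _; elim: t => [_|t IH tN] /=; first by rewrite q0 x0.
rewrite IH ?(ltnW tN)//= scale0r addr0.
by have [-> -> _] := dynE _ tN.
Qed.

Lemma variation_linear k v w t : (t <= N)%N ->
  variation (k *: v + w) t = k *: variation v t + variation w t.
Proof.
elim: t => [_|t IH tN] /=; first by congr (_, _); rewrite /= scaler0 addr0.
have lS := diff_within_linear (dS tN); have lF := diff_within_linear (dF tN).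
rewrite IH ?(ltnW tN)//=.
case: (variation v t) (variation w t) => [hv yv] [hw yw] /=.
set s := gstep P t (q t) (x t).
have E1 : (q t *m (k *: hv + hw), k *: yv + yw) =
    k *: (q t *m hv, yv) + (q t *m hw, yw) :> 'M[R]_m * 'cV[R]_nx.
  by congr (_, _); rewrite mulmxDr -scalemxAr.
have E2 : (q t *m (k *: hv + hw), k *: yv + yw, (k *: v + w) t) =
    k *: (q t *m hv, yv, v t) + (q t *m hw, yw, w t)
    :> 'M[R]_m * 'cV[R]_nx * 'cV[R]_nu.
  by rewrite E1.
rewrite E2 lF E1 lS mulmxDl -scalemxAl; congr (_, _).
by rewrite addrACA -scalerDr mulmxDr -scalemxAr.
Qed.

Lemma velocity_linear k v w t : (t <= N)%N ->
  velocity (k *: v + w) t = k *: velocity v t + velocity w t.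
Proof.
move=> tN; rewrite /velocity variation_linear//.
by congr (_, _); rewrite /= mulmxDr -scalemxAr.
Qed.

(** The derivative and the membership in [g] are proved together. The product rule gives the next
    velocity, and since the perturbed trajectory is a curve in [G], its left-trivialized velocity
    lies in [g]. *)
Lemma trajectory_derive v t : (t <= N)%N ->
  (variation v t).1 \in g /\
  is_derive (0 : R) 1 (fun e => trajectory v e t) (velocity v t).
Proof.
have [Gq _ dynE _] := adm.
elim: t => [_|t IH tN] /=.
  split; first exact: mem0v.
  by rewrite /velocity /= mulmx0; exact: is_derive_cst.
have {IH} [gh dc] := IH (ltnW tN); have tN' := ltnW tN.
have c0 := trajectory0 v tN'.
have [qS xS _] := dynE _ tN.
set s := gstep P t (q t) (x t); have Gs : G s by apply: Gstep => //; exact: Gq.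
have us := lie_unit lieG Gs.
have ds : is_derive (0 : R) 1
    (fun e => gstep P t (trajectory v e t).1 (trajectory v e t).2)
    (LS t (velocity v t)).
  have dS0 := dS tN; rewrite -c0 in dS0.
  apply: (diff_within_curve dS0 dc).
  by apply: near0W => e /=; exact: trajectory_lie.
have dq := is_derive_mulmx (is_diff_curve (is_diff_fst _) dc) ds.
have dx : is_derive (0 : R) 1
    (fun e => dyn P t (trajectory v e t).1 (trajectory v e t).2 (u t + e *: v t))
    (LF t (velocity v t, v t)).
  have dp := is_derive_pair dc (is_derive_affine (u t) (v t) 0).
  have dF0 := dF tN; rewrite -c0 -[u t]addr0 -[X in u t + X](scale0r (v t)) in dF0.
  apply: (diff_within_curve dF0 dp).
  by apply: near0W => e /=; exact: trajectory_lie.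
set h' := invmx s *m _.
(* The product rule output equals [q t.+1 *m h'] because [q t.+1 = q t *m s]: the recursion defining
   [variation] is the linearized dynamics. *)
have vE : (velocity v t).1 *m gstep P t (trajectory v 0 t).1 (trajectory v 0 t).2 +
    (trajectory v 0 t).1 *m LS t (velocity v t) = q t.+1 *m h'.
  rewrite c0 /= -/s qS -/s /h' -[RHS]mulmxA mulKVmx// mulmxDr mulmxA.
  by [].
rewrite vE in dq.
have gh' : h' \in g.
  rewrite -(mulKmx (lie_unit lieG (Gq _ tN)) h').
  apply: (lie_tangent lieG lie_g (Gq _ tN) _ dq); first by rewrite c0 qS.
  by apply: near0W => e; exact: (@trajectory_lie v e t.+1 tN).
split=> //; exact: (is_derive_pair dq dx).
Qed.

Lemma is_derive_trajectory (W : normedModType R) (f : 'M[R]_m * 'cV[R]_nx -> W) L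
    v t : (t <= N)%N ->
  diff_within [set p : 'M[R]_m * 'cV[R]_nx | G p.1] f (q t, x t) L ->
  is_derive (0 : R) 1 (fun e => f (trajectory v e t)) (L (velocity v t)).
Proof.
move=> tN; rewrite -(trajectory0 v tN) => df.
apply: (diff_within_curve df); first exact: (trajectory_derive v tN).2.
by apply: near0W => e; exact: trajectory_lie.
Qed.

Lemma is_derive_trajectory_ctrl (W : normedModType R)
    (f : 'M[R]_m * 'cV[R]_nx * 'cV[R]_nu -> W) L v t : (t <= N)%N ->
  diff_within [set p : 'M[R]_m * 'cV[R]_nx * 'cV[R]_nu | G p.1.1] f
    (q t, x t, u t) L ->
  is_derive (0 : R) 1 (fun e => f (trajectory v e t, u t + e *: v t))
    (L (velocity v t, v t)).
Proof.
move=> tN; rewrite -(trajectory0 v tN).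
rewrite -[u t in X in X -> _]addr0 -[X in u t + X](scale0r (v t)) => df.
apply: (diff_within_curve df).
  apply: is_derive_pair; first exact: (trajectory_derive v tN).2.
  exact: is_derive_affine.
by apply: near0W => e; exact: trajectory_lie.
Qed.

End Variation.

Lemma convex_set_combination (R : realType) (V : lmodType R) (C : set V) a b (t : R) :
  convex_set C -> C a -> C b -> 0 <= t <= 1 -> C (t *: a + (1 - t) *: b).
Proof.
move=> cC Ca Cb /andP[t0 t1].
have := cC a b (Itv01 t0 t1); rewrite !inE => /(_ Ca Cb).
by rewrite /conv /=.
Qed.

(** * First-order necessary conditions with multipliers *)

Section DescentDirections.
Context {R : realType} {m nx nu : nat} {P : ocp R m nx nu} {G : set 'M[R]_m}
  {g : {vspace 'M[R]_m}}.
Hypotheses (lieG : matrix_lie_group G) (lie_g : lie_algebra_of G g).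
Local Notation N := (horizon P).
Hypothesis Gstep : forall t, (t < N)%N -> forall q x, G q -> G (gstep P t q x).
Hypothesis ctrl_convex : forall t, (t < N)%N -> convex_set (ctrl P t).
Context {q : nat -> 'M[R]_m} {x : nat -> 'cV[R]_nx} {u : nat -> 'cV[R]_nu}.
Hypothesis opt : optimal P G q x u.
Context {LS : nat -> 'M[R]_m * 'cV[R]_nx -> 'M[R]_m}
  {LF : nat -> 'M[R]_m * 'cV[R]_nx * 'cV[R]_nu -> 'cV[R]_nx}
  {LC : nat -> 'M[R]_m * 'cV[R]_nx * 'cV[R]_nu -> R^o}
  {LE : 'M[R]_m * 'cV[R]_nx -> R^o}
  {LG : forall t, 'M[R]_m * 'cV[R]_nx -> 'cV[R]_(ncstr P t)}.
Hypotheses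
  (dS : forall t, (t < N)%N -> diff_within [set p : 'M[R]_m * 'cV[R]_nx | G p.1]
     (fun p => gstep P t p.1 p.2) (q t, x t) (LS t))
  (dF : forall t, (t < N)%N ->
     diff_within [set p : 'M[R]_m * 'cV[R]_nx * 'cV[R]_nu | G p.1.1]
     (fun p => dyn P t p.1.1 p.1.2 p.2) (q t, x t, u t) (LF t))
  (dC : forall t, (t < N)%N ->
     diff_within [set p : 'M[R]_m * 'cV[R]_nx * 'cV[R]_nu | G p.1.1]
     (fun p => cost P t p.1.1 p.1.2 p.2 : R^o) (q t, x t, u t) (LC t))
  (dE : diff_within [set p : 'M[R]_m * 'cV[R]_nx | G p.1]
     (fun p => cost_end P p.1 p.2 : R^o) (q N, x N) LE)
  (dG : forall t, (0 < t <= N)%N ->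
     diff_within [set p : 'M[R]_m * 'cV[R]_nx | G p.1]
     (fun p => cstr P t p.1 p.2) (q t, x t) (LG t)).
Implicit Types (v : nat -> 'cV[R]_nu).

Local Notation vel := (velocity (P := P) (q := q) (x := x) (LS := LS) (LF := LF)).
Local Notation traj := (trajectory (P := P) (u := u)).

Definition dcost v : R :=
  \sum_(t < N) LC t (vel v t, v t) + LE (vel v N).

Let adm := opt.1.

Let traj_cost v (e : R) := total_cost P (fun t => (traj v e t).1)
  (fun t => (traj v e t).2) (fun t => u t + e *: v t).

Lemma is_derive_total_cost v :
  is_derive (0 : R) 1 (traj_cost v : R -> R^o) (dcost v).
Proof.
pose f (t : 'I_N) (e : R) : R^o :=
  cost P t (traj v e t).1 (traj v e t).2 (u t + e *: v t).
have df t : is_derive (0 : R) 1 (f t) (LC t (vel v t, v t)).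
  exact: (is_derive_trajectory_ctrl lieG lie_g Gstep adm dS dF v (ltnW (ltn_ord t))
    (dC (ltn_ord t))).
have dfE := is_derive_trajectory lieG lie_g Gstep adm dS dF v (leqnn N) dE.
have := is_deriveD (is_derive_sum df) dfE.
suff -> : traj_cost v = \sum_(t < N) f t +
    (fun e => cost_end P (traj v e N).1 (traj v e N).2 : R^o) by [].
by apply/funext => e; rewrite /traj_cost /total_cost !fctE fct_sumE.
Qed.

(** An active constraint decreases strictly for small [e > 0] by its negative slope; an inactive one
    stays negative by continuity. *)
Lemma constraint_near v t (j : 'I_(ncstr P t)) : (0 < t <= N)%N ->
  (cstr P t (q t) (x t) j 0 = 0 -> LG t (vel v t) j 0 < 0) ->
  \forall e \near (0 : R)^'+, cstr P t (traj v e t).1 (traj v e t).2 j 0 <= 0.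
Proof.
move=> tN act; have tN' : (t <= N)%N by case/andP: tN.
have [Gq _ _ /(_ t tN j) cj] := adm.
have lj : linear (fun X : 'cV[R]_(ncstr P t) => X j 0 : R^o).
  by move=> k a b; rewrite !mxE.
have dj := diff_within_mx_linear lj (dG tN) (Gq _ tN').
have dtj := is_derive_trajectory lieG lie_g Gstep adm dS dF v tN' dj.
have c0 : cstr P t (traj v 0 t).1 (traj v 0 t).2 j 0 = cstr P t (q t) (x t) j 0.
  by rewrite (trajectory0 adm).
have [cj0|cj0] := eqVneq (cstr P t (q t) (x t) j 0) 0.
  have := is_derive_lt0_right dtj (act cj0).
  by apply: filterS => e /=; rewrite c0 cj0 => /ltW.
have lt0 : cstr P t (traj v 0 t).1 (traj v 0 t).2 j 0 < 0 by rewrite c0 lt_neqAle cj0.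
have H : \forall e \near (0 : R), cstr P t (traj v e t).1 (traj v e t).2 j 0 < 0 :> R^o.
  exact: (cvgr_lt _ (is_derive_cvg dtj) _ lt0).
by rewrite near_withinE; apply: filterS H => e /ltW.
Qed.

Lemma no_descent_direction v : (forall t, (t < N)%N -> ctrl P t (u t + v t)) ->
  (forall t (j : 'I_(ncstr P t)), (0 < t <= N)%N ->
     cstr P t (q t) (x t) j 0 = 0 -> LG t (vel v t) j 0 < 0) ->
  0 <= dcost v.
Proof.
move=> uv act; rewrite leNgt; apply/negP => dlt0.
have [Gq _ dynE cstrE] := adm.
have Jlt := is_derive_lt0_right (is_derive_total_cost v) dlt0.
(* There are finitely many pairs of a time and a constraint index, so a single [e] serves all of
   them. Time 0 is excluded since it carries no constraint. *)
have Hc : \forall e \near (0 : R)^'+,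
    forall p : {t : 'I_N.+1 & 'I_(ncstr P t)}, (0 < tag p)%N ->
      cstr P (tag p) (traj v e (tag p)).1 (traj v e (tag p)).2 (tagged p) 0 <= 0.
  apply: filter_forall => -[t j] /=.
  have [t0|t0] := ltnP 0 t; last by near=> e.
  have tN : (0 < t <= N)%N by rewrite t0 -ltnS ltn_ord.
  by apply: filterS (constraint_near tN (act t j tN)).
near (0 : R)^'+ => e.
have e0 : 0 < e by [].
have e1 : e <= 1 by near: e; exact: nbhs_right_le.
have : total_cost P q x u <= traj_cost v e.
  apply: opt.2; split.
  - by move=> t tN; exact: (trajectory_lie lieG Gstep adm).
  - by [].
  - move=> t tN; split => //.
    have [_ _ ut] := dynE _ tN.
    (* The perturbed control [u t + e *: v t] is the convex combination of [u t + v t] and [u t]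
       with weight [e]. *)
    have := convex_set_combination (ctrl_convex tN) (uv t tN) ut.
    move=> /(_ e); rewrite (ltW e0) e1 => /(_ isT).
    by rewrite scalerDr addrAC -scalerDl [e + _]addrC subrK scale1r.
  - move=> t tN j; have tN' : (t < N.+1)%N by rewrite ltnS; case/andP: tN.
    have := near Hc e; rewrite /= => /(_ _).
    move=> /(_ _ (Tagged (fun t : 'I_N.+1 => 'I_(ncstr P t)) (j : 'I_(ncstr P (Ordinal tN'))))).
    by apply => //; case/andP: tN.
have -> : total_cost P q x u = traj_cost v 0.
  rewrite /traj_cost /total_cost !(trajectory0 adm)//; congr (_ + _).
  apply: eq_bigr => t _; rewrite !(trajectory0 adm) ?(ltnW (ltn_ord t))//.
  by rewrite scale0r addr0.
by rewrite leNgt (near Jlt e).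
Unshelve. all: by end_near. Qed.

Lemma dcost_linear : scalar dcost.
Proof.
move=> k v w; rewrite /dcost (velocity_linear dS dF)// (diff_within_linear dE).
rewrite mulrDr mulr_sumr addrACA -big_split/=; congr (_ + _).
apply: eq_bigr => t _; rewrite (velocity_linear dS dF) ?(ltnW (ltn_ord t))//.
exact: (diff_within_linear (dC (ltn_ord t)) k (vel v t, v t) (vel w t, w t)).
Qed.

Lemma dcstr_linear t (j : 'I_(ncstr P t)) : (0 < t <= N)%N ->
  scalar (fun v => LG t (vel v t) j 0).
Proof.
move=> tN k v w; rewrite (velocity_linear dS dF) ?(andP tN).2//.
by rewrite (diff_within_linear (dG tN)) !mxE.
Qed.

(** The theorem of the alternative for the linearized cost and active constraints, on the convex set
    of variations that keep the controls in their sets. *)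
Lemma fritz_john : exists (l0 : R) (l : forall t, 'I_(ncstr P t) -> R),
  [/\ 0 <= l0 /\ (forall t j, 0 <= l t j),
      forall t j, (0 < t <= N)%N -> l t j * cstr P t (q t) (x t) j 0 = 0,
      0 < l0 \/ exists t j, (0 < t <= N)%N /\ 0 < l t j &
      forall v, (forall t, (t < N)%N -> ctrl P t (u t + v t)) ->
        0 <= l0 * dcost v +
             \sum_(t < N) \sum_(j < ncstr P t.+1) l t.+1 j * LG t.+1 (vel v t.+1) j 0].
Proof.
have [_ _ dynE cstrE] := adm.
(* [None] stands for the cost, and [Some] of a pair for a constraint, with times shifted by one
   because constraints start at time 1. *)
pose T := option {t : 'I_N & 'I_(ncstr P t.+1)}.
pose A : {pred T} := fun p => if p is Some p then
  cstr P (tag p).+1 (q (tag p).+1) (x (tag p).+1) (tagged p) 0 == 0 else true.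
pose f (p : T) v : R := if p is Some p then
  LG (tag p).+1 (vel v (tag p).+1) (tagged p) 0 else dcost v.
pose C := [set v : nat -> 'cV[R]_nu | forall t, (t < N)%N -> ctrl P t (u t + v t)].
have tN (t : 'I_N) : (0 < t.+1 <= N)%N by rewrite ltn_ord.
have [||||l [l0 lA [p0 lp0] lC]] := @alternative_fin R _ T A None C f.
- by [].
- move=> a b Ca Cb t t01 k kN.
  have := convex_set_combination (ctrl_convex kN) (Ca k kN) (Cb k kN) t01.
  by rewrite !scalerDr addrACA -scalerDl [t + _]addrC subrK scale1r.
- by case=> [[t j]|]; [exact: dcstr_linear (tN t)|exact: dcost_linear].
(* If all active constraints had negative derivative, [no_descent_direction] would make the cost
   form nonnegative, so some form in [A] is nonnegative in any case. *)
- move=> v Cv; apply: contrapT => nex.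
  have : 0 <= dcost v.
    apply: no_descent_direction => // -[//|t] j tN' cj.
    have tlt : (t < N)%N by case/andP: tN'.
    rewrite ltNge; apply/negP => ge0; apply: nex.
    exists (Some (Tagged (fun t : 'I_N => 'I_(ncstr P t.+1))
      (j : 'I_(ncstr P (Ordinal tlt).+1)))) => //.
    by rewrite unfold_in /A /= cj.
  by move=> ge0; apply: nex; exists None.
(* The multipliers are extended by 0 to time 0 and to times beyond the horizon. *)
pose lt t : 'I_(ncstr P t) -> R := match t with
  | 0 => fun=> 0
  | k.+1 => fun j => if @idP (k < N)%N is ReflectT h then
      l (Some (Tagged (fun t : 'I_N => 'I_(ncstr P t.+1))
        (j : 'I_(ncstr P (Ordinal h).+1)))) else 0 end.
have ltE (t : 'I_N) (j : 'I_(ncstr P t.+1)) :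
    lt t.+1 j = l (Some (Tagged (fun t : 'I_N => 'I_(ncstr P t.+1)) j)).
  case: t j => t ht j; rewrite /lt; case: {-}_ / idP => [h|//].
  by rewrite (bool_irrelevance h ht).
exists (l None), lt; split.
- split=> // -[|t] j //=; by case: {-}_ / idP.
- case=> [//|t] j tN'; have tlt : (t < N)%N by case/andP: tN'.
  rewrite (ltE (Ordinal tlt)).
  have [/eqP->|cn0] := boolP (cstr P t.+1 (q t.+1) (x t.+1) j 0 == 0).
    by rewrite mulr0.
  by rewrite lA ?mul0r// unfold_in /A /=.
- case: p0 lp0 => [[t j] lp0|]; last by left.
  by right; exists t.+1, j; rewrite ltE.
move=> v Cv; have := lC v Cv.
suff -> : \sum_p l p * f p v = l None * dcost v +
    \sum_(t < N) \sum_(j < ncstr P t.+1) lt t.+1 j * LG t.+1 (vel v t.+1) j 0 by [].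
have -> : \sum_(t < N) \sum_(j < ncstr P t.+1) lt t.+1 j * LG t.+1 (vel v t.+1) j 0 =
    \sum_(t < N) \sum_(j < ncstr P t.+1)
      l (Some (Tagged (fun t : 'I_N => 'I_(ncstr P t.+1)) j)) *
      LG t.+1 (vel v t.+1) j 0.
  by apply: eq_bigr => t _; apply: eq_bigr => j _; rewrite ltE.
rewrite (bigD1 None)//=; congr (_ + _).
rewrite (@sig_big_dep _ _ _ _ (fun t : 'I_N => 'I_(ncstr P t.+1)) xpredT
  (fun=> xpredT) (fun t j => l (Some (Tagged (fun t : 'I_N => 'I_(ncstr P t.+1)) j)) *
  LG t.+1 (vel v t.+1) j 0)) /=.
rewrite (reindex_omap Some id) => [|[]//] /=.
by apply: eq_big => [[t j]|[t j] _]; rewrite ?eqxx.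
Qed.

End DescentDirections.

(** * The adjoint system *)

(** Choice turns the step relation into a function, with [z0] as default outside the time range,
    which is then iterated in reversed time. *)
Lemma backward_recursion (T : Type) (N : nat) (Q : T -> Prop)
    (S : nat -> T -> T -> Prop) : (0 < N)%N -> (exists z, Q z) ->
  (forall t z, (0 < t < N)%N -> exists z', S t z z') ->
  exists z : nat -> T, Q (z N.-1) /\ forall t, (0 < t < N)%N -> S t (z t) (z t.-1).
Proof.
move=> N0 [z0 Qz0] HS.
have /choice[f fS] (p : nat * T) : exists z', (0 < p.1 < N)%N -> S p.1 p.2 z'.
  have [pN|_] := boolP (0 < p.1 < N)%N.
    by have [z' Sz'] := HS p.1 p.2 pN; exists z'.
  by exists z0.
(* [zz k] is the value at time [N.-1 - k], so the step out of [zz j] is the one of time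
   [N.-1 - j]. *)
pose zz := fix zz k := if k is j.+1 then f ((N.-1 - j)%N, zz j) else z0.
exists (fun t => zz (N.-1 - t)%N); split; first by rewrite subnn.
move=> t tN; have /andP[t0 tN'] := tN.
have -> : (N.-1 - t.-1 = (N.-1 - t).+1)%N by lia.
rewrite /= -/zz (_ : (N.-1 - (N.-1 - t))%N = t); last by lia.
exact: (fS (t, _)).
Qed.

Section AdjointIdentity.
Context {R : realType} {m nx nu : nat} {P : ocp R m nx nu} {G : set 'M[R]_m}
  {g : {vspace 'M[R]_m}} {O : set 'M[R]_m}.
Hypotheses (lieG : matrix_lie_group G) (lie_g : lie_algebra_of G g)
  (Og : open_in [set` g] O) (expO : open_in G (@expmx R m @` O))
  (diffO : diffeo_on O (@expmx R m @` O) (@expmx R m)).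
Local Notation N := (horizon P).
Hypothesis Gstep : forall t, (t < N)%N -> forall q x, G q -> G (gstep P t q x).
Context {q : nat -> 'M[R]_m} {x : nat -> 'cV[R]_nx} {u : nat -> 'cV[R]_nu}.
Hypothesis adm : admissible P G q x u.
Hypothesis Es : forall t, (t < N)%N -> (@expmx R m @` O) (gstep P t (q t) (x t)).
Context {LS : nat -> 'M[R]_m * 'cV[R]_nx -> 'M[R]_m}
  {LF : nat -> 'M[R]_m * 'cV[R]_nx * 'cV[R]_nu -> 'cV[R]_nx}
  {LC : nat -> 'M[R]_m * 'cV[R]_nx * 'cV[R]_nu -> R^o}
  {LL : nat -> 'M[R]_m -> 'M[R]_m}
  {LE : 'M[R]_m * 'cV[R]_nx -> R^o}
  {LG : forall t, 'M[R]_m * 'cV[R]_nx -> 'cV[R]_(ncstr P t)}.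
Hypotheses
  (dS : forall t, (t < N)%N -> diff_within [set p : 'M[R]_m * 'cV[R]_nx | G p.1]
     (fun p => gstep P t p.1 p.2) (q t, x t) (LS t))
  (dF : forall t, (t < N)%N ->
     diff_within [set p : 'M[R]_m * 'cV[R]_nx * 'cV[R]_nu | G p.1.1]
     (fun p => dyn P t p.1.1 p.1.2 p.2) (q t, x t, u t) (LF t))
  (dC : forall t, (t < N)%N ->
     diff_within [set p : 'M[R]_m * 'cV[R]_nx * 'cV[R]_nu | G p.1.1]
     (fun p => cost P t p.1.1 p.1.2 p.2 : R^o) (q t, x t, u t) (LC t))
  (dL : forall t, (t < N)%N ->
     diff_within (@expmx R m @` O) (logmx O) (gstep P t (q t) (x t)) (LL t))
  (dE : diff_within [set p : 'M[R]_m * 'cV[R]_nx | G p.1]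
     (fun p => cost_end P p.1 p.2 : R^o) (q N, x N) LE)
  (dG : forall t, (0 < t <= N)%N ->
     diff_within [set p : 'M[R]_m * 'cV[R]_nx | G p.1]
     (fun p => cstr P t p.1 p.2) (q t, x t) (LG t)).
Context {nu_ : R} {zeta : nat -> dualv g} {xi : nat -> 'rV[R]_nx}
  {mu : forall t, 'rV[R]_(ncstr P t)}.

Local Notation vel := (velocity (P := P) (q := q) (x := x) (LS := LS) (LF := LF)).
Local Notation var := (variation (P := P) (q := q) (x := x) (LS := LS) (LF := LF)).
Let s t := gstep P t (q t) (x t).
Let dH t := dHam (nu_ := nu_) (zeta := zeta t) (xi := xi t) (LS := LS t)
  (LF := LF t) (LC := LC t) (LL := LL t).
Let muG t p := (mu t *m LG t p) 0 0.

Hypotheses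
  (rho_step : forall t, (0 < t < N)%N -> forall w : subvs_of g,
     DlogStar O (s t.-1) (zeta t.-1) w = adjoint_rhs (P := P) (t := t)
       (q := q t) (x := x t) (nu_ := nu_) (zeta := zeta t) (xi := xi t)
       (LS := LS t) (LF := LF t) (LC := LC t) (LL := LL t) (LG := LG t)
       (mu := mu t) w)
  (xi_step : forall t, (0 < t < N)%N -> xi t.-1 =
     DxH P O nu_ t (zeta t) (xi t) (q t) (x t) (u t) + muDxg (mu t) (q t) (x t))
  (rho_end : forall w : subvs_of g, DlogStar O (s N.-1) (zeta N.-1) w =
     nu_ * LE (q N *m vsval w, 0) + muG N (q N *m vsval w, 0))
  (xi_end : xi N.-1 =
     nu_ *: Dxcend P (q N) (x N) + muDxg (mu N) (q N) (x N)).

Let pairing (v : nat -> 'cV[R]_nu) k : R :=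
  DlogStar O (s k) (zeta k) (vsproj g (var v k.+1).1) + (xi k *m (var v k.+1).2) 0 0.

Let muGD t (h : 'M[R]_m) (y : 'cV[R]_nx) : (0 < t <= N)%N ->
  muG t (h, y) = muG t (h, 0) + muG t (0, y).
Proof.
move=> tN; have lG := diff_within_linear (dG tN).
have -> : (h, y) = 1 *: (h, 0) + (0, y) :> 'M[R]_m * 'cV[R]_nx.
  by rewrite scale1r; congr (_, _); rewrite /= ?addr0 ?add0r.
by rewrite /muG lG scale1r mulmxDr mxE.
Qed.

(** The telescoping argument. The adjoint equations at [k.+1] rewrite [pairing v k] with the same
    state terms that the linearized dynamics give for [pairing v k.+1]; the difference consists of
    the control part of the Hamiltonian, the cost and the constraint terms. *)
Lemma pairing_step (v : nat -> 'cV[R]_nu) k : (k < N)%N ->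
  pairing v k = \sum_(i < k.+1) dH i (0, 0, v i)
    - nu_ * \sum_(i < k.+1) LC i (vel v i, v i)
    - \sum_(i < k) muG i.+1 (vel v i.+1).
Proof.
have [Gq _ _ _] := adm.
have AP t (tN : (t < N)%N) : pairing v t =
    zeta t (vsproj g (LL t ((var v t).1 *m s t))) + dH t (vel v t, v t)
    - nu_ * LC t (vel v t, v t).
  rewrite /pairing; have [gh' _] := trajectory_derive lieG lie_g Gstep adm dS dF v tN.
  exact: (adjoint_pairing lieG lie_g Og expO diffO (Es tN) (dL tN)).
have SP t (tN : (t < N)%N) h y : dH t (h, y, v t) =
    dH t (h, 0, 0) + dH t (0, y, 0) + dH t (0, 0, v t).
  exact: (dHam_split expO (Gq t (ltnW tN)) (Gstep tN) (Es tN) (dS tN) (dF tN)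
    (dC tN) (dL tN)).
elim: k => [|k IH] kN.
  (* The initial state is fixed, so its variation is zero. *)
  rewrite AP// !big_ord1 big_ord0 subr0 /velocity /= mul0mx mulmx0.
  have lL := diff_within_linear (dL kN).
  have -> : LL 0%N 0 = 0.
    by have := lL (-1) 0 0; rewrite scaler0 addr0 scaleN1r addNr.
  by rewrite !linear0 add0r.
have kN' := ltnW kN; have kN1 : (0 < k.+1 < N)%N by [].
have kN2 : (0 < k.+1 <= N)%N by [].
have pk : pairing v k = zeta k.+1 (vsproj g (LL k.+1 ((var v k.+1).1 *m s k.+1))) +
    dH k.+1 (q k.+1 *m (var v k.+1).1, 0, 0) + dH k.+1 (0, (var v k.+1).2, 0) +
    muG k.+1 (vel v k.+1).
  have [gh _] := trajectory_derive lieG lie_g Gstep adm dS dF v kN'.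
  rewrite /pairing (rho_step kN1) (xi_step kN1) mulmxDl mxE.
  rewrite (DxHE expO (Gq _ kN') (Gstep kN) (Es kN) (dS kN) (dF kN) (dC kN) (dL kN)).
  rewrite (muDxgE (Gq _ kN') (dG kN2)) /adjoint_rhs vsprojK//.
  rewrite /velocity muGD// -/(dH k.+1) -/(s k.+1) -/(muG k.+1 (_, _)).
  have E (a b c d e : R) : a + (b + c) + (d + e) = a + b + d + (c + e) by ring.
  exact: E.
rewrite AP// [\sum_(i < k.+2) dH _ _]big_ord_recr [\sum_(i < k.+2) LC _ _]big_ord_recr.
rewrite [\sum_(i < k.+1) muG _ _]big_ord_recr /=.
have dHv : dH k.+1 (vel v k.+1, v k.+1) = dH k.+1 (q k.+1 *m (var v k.+1).1, 0, 0) +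
    dH k.+1 (0, (var v k.+1).2, 0) + dH k.+1 (0, 0, v k.+1) by exact: SP.
have := IH kN'; rewrite pk dHv.
move: (\sum_(i < k.+1) dH _ _) (\sum_(i < k.+1) LC _ _) (\sum_(i < k) muG _ _) => A B C.
have E (a b c d e f : R) : a + b + c + d = A - nu_ * B - C ->
    a + (b + c + e) - nu_ * f = A + e - nu_ * (B + f) - (C + d).
  by move=> H; transitivity (a + b + c + d - d + e - nu_ * f); [|rewrite H]; ring.
exact: E.
Qed.

(** The transversality conditions evaluate the last pairing, and comparison with [pairing_step] at
    [N.-1] adds the terminal cost and the last constraint to the sums. *)
Lemma adjoint_identity (v : nat -> 'cV[R]_nu) : (0 < N)%N ->
  \sum_(i < N) dH i (0, 0, v i) =
  nu_ * (\sum_(i < N) LC i (vel v i, v i) + LE (vel v N)) +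
  \sum_(i < N) muG i.+1 (vel v i.+1).
Proof.
move=> N0; have [Gq _ _ _] := adm.
have NE : N.-1.+1 = N by rewrite prednK.
have tN : (N.-1 < N)%N by rewrite NE.
have NN : (0 < N <= N)%N by rewrite N0 leqnn.
have := pairing_step v tN.
have -> : pairing v N.-1 = nu_ * LE (vel v N) + muG N (vel v N).
  have [gh _] := trajectory_derive lieG lie_g Gstep adm dS dF v (leqnn N).
  rewrite /pairing NE rho_end xi_end vsprojK// mulmxDl mxE.
  rewrite (muDxgE (Gq _ (leqnn N)) (dG NN)).
  rewrite -scalemxAl mxE (DxcendE (Gq _ (leqnn N)) dE).
  have -> : muG N (vel v N) = muG N (q N *m (var v N).1, 0) + muG N (0, (var v N).2).
    exact: muGD.
  have -> : LE (vel v N) = LE (q N *m (var v N).1, 0) + LE (0, (var v N).2).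
    rewrite -[LE (_, 0)]scale1r -(diff_within_linear dE) scale1r /velocity.
    by congr (LE (_, _)); rewrite /= ?addr0 ?add0r.
  have E (a b c d e : R) : a * b + c + (a * d + e) = a * (b + d) + (c + e) by ring.
  exact: E.
rewrite NE -[in X in _ -> _ = _ + X]NE big_ord_recr /= NE.
move: (\sum_(i < N) dH _ _) (\sum_(i < N) LC _ _) (\sum_(i < N.-1) muG _ _) => A B C.
have E (a b : R) : nu_ * a + b = A - nu_ * B - C -> A = nu_ * (B + a) + (C + b).
  by move=> H; transitivity (A - nu_ * B - C + nu_ * B + C); [|rewrite -H]; ring.
exact: E.
Qed.

End AdjointIdentity.

(** * The maximum principle *)

Unset Implicit Arguments.

Theorem theorem2p5 (R : realType) (m nx nu nq : nat)
    (G : set 'M[R]_m) (g : {vspace 'M[R]_m}) (O : set 'M[R]_m)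
    (P : ocp R m nx nu)
    (q : nat -> 'M[R]_m) (x : nat -> 'cV[R]_nx) (u : nat -> 'cV[R]_nu) :
  matrix_lie_group G ->
  lie_algebra_of G g ->
  \dim g = nq ->
  well_posed P G ->
  smooth_data P G ->
  exp_chart P G (g := g) O ->
  (forall t, (t < horizon P)%N -> convex_set (ctrl P t)) ->
  optimal P G q x u ->
  exists (zeta : nat -> dualv g) (xi : nat -> 'rV[R]_nx)
      (mu : forall t, 'rV[R]_(ncstr P t)) (nu0 : R),
    let N := horizon P in
    let Dz t := DzetaH P O nu0 t (zeta t) (xi t) (q t) (x t) (u t) in
    let Dxi t := DxiH P O nu0 t (zeta t) (xi t) (q t) (x t) (u t) in
    let Dq t := DqH P O nu0 t (zeta t) (xi t) (q t) (x t) (u t) in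
    let Dx t := DxH P O nu0 t (zeta t) (xi t) (q t) (x t) (u t) in
    let Du t := DuH P O nu0 t (zeta t) (xi t) (q t) (x t) (u t) in
    let rho t := DlogStar O (expmx (vsval (Dz t))) (zeta t) in
    (nu0 = -1 \/ nu0 = 0) /\
    (* (i) *)
    (forall t, (t < N)%N ->
      q t.+1 = q t *m expmx (vsval (Dz t)) /\ x t.+1 = Dxi t) /\
    (forall t, (0 < t < N)%N ->
      rho t.-1 = AdStar (expmx (- vsval (Dz t))) (rho t) \+
                 TPhiStar (q t) (Dq t \+ muDqg (mu t) (q t) (x t)) /\
      xi t.-1 = Dx t + muDxg (mu t) (q t) (x t)) /\
    (* (ii) *)
    (rho N.-1 = TPhiStar (q N) ((nu0 \*o Dqcend P (q N) (x N)) \+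
                                muDqg (mu N) (q N) (x N)) /\
     xi N.-1 = nu0 *: Dxcend P (q N) (x N) + muDxg (mu N) (q N) (x N)) /\
    (* (iii) *)
    (forall t, (t < N)%N -> forall w, ctrl P t w -> (Du t *m (w - u t)) 0 0 <= 0) /\
    (* (iv) *)
    (forall t, (0 < t <= N)%N -> forall j, mu t 0 j * cstr P t (q t) (x t) j 0 = 0) /\
    (* (v) *)
    (forall t, (0 < t <= N)%N -> forall j, mu t 0 j <= 0) /\
    (* (vi) *)
    ~ [/\ forall t, (t < N)%N -> zeta t = 0 /\ xi t = 0,
          forall t, (0 < t <= N)%N -> mu t = 0 & nu0 = 0].

Proof.
move=> lieG lie_g _ [N0 Gstep _ Gq0] [sS sF sC sE sG] [Og expO diffO chartE] cvx opt.
have adm := opt.1; have [Gq _ dynE cstrE] := adm.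
have Es t : (t < horizon P)%N -> (@expmx R m @` O) (gstep P t (q t) (x t)).
  exact: (chartE _ _ _ adm).
have GqN := Gq _ (leqnn (horizon P)).
have /choice[LS dS] t : exists L, (t < horizon P)%N ->
    diff_within [set p : 'M[R]_m * 'cV[R]_nx | G p.1]
      (fun p => gstep P t p.1 p.2) (q t, x t) L.
  have [tN|_] := boolP (t < horizon P)%N; last by exists (fun=> 0).
  by have [|L dL] := smooth_on_diff_within (a := (q t, x t)) (sS t tN);
    [exact: Gq (ltnW tN)|exists L].
have /choice[LF dF] t : exists L, (t < horizon P)%N ->
    diff_within [set p : 'M[R]_m * 'cV[R]_nx * 'cV[R]_nu | G p.1.1]
      (fun p => dyn P t p.1.1 p.1.2 p.2) (q t, x t, u t) L.
  have [tN|_] := boolP (t < horizon P)%N; last by exists (fun=> 0).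
  by have [|L dL] := smooth_on_diff_within (a := (q t, x t, u t)) (sF t tN);
    [exact: Gq (ltnW tN)|exists L].
have /choice[LC dC] t : exists L, (t < horizon P)%N ->
    diff_within [set p : 'M[R]_m * 'cV[R]_nx * 'cV[R]_nu | G p.1.1]
      (fun p => cost P t p.1.1 p.1.2 p.2 : R^o) (q t, x t, u t) L.
  have [tN|_] := boolP (t < horizon P)%N; last by exists (fun=> 0).
  by have [|L dL] := smooth_on_diff_within (a := (q t, x t, u t)) (sC t tN);
    [exact: Gq (ltnW tN)|exists L].
have /choice[LL dL] t : exists L, (t < horizon P)%N ->
    diff_within (@expmx R m @` O) (logmx O) (gstep P t (q t) (x t)) L.
  have [tN|_] := boolP (t < horizon P)%N; last by exists (fun=> 0).
  have [_ _ sL] := diffO; have [L dL] := smooth_on_diff_within sL (Es t tN).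
  by exists L.
have [LE dE] := smooth_on_diff_within (a := (q (horizon P), x (horizon P))) sE GqN.
have exG t : exists L, (0 < t <= horizon P)%N ->
    diff_within [set p : 'M[R]_m * 'cV[R]_nx | G p.1]
      (fun p => cstr P t p.1 p.2) (q t, x t) L.
  have [tN|_] := boolP (0 < t <= horizon P)%N; last by exists (fun=> 0).
  have tN' : (t <= horizon P)%N by case/andP: tN.
  by have [|L dG] := smooth_on_diff_within (a := (q t, x t)) (sG t tN);
    [exact: Gq|exists L].
(* The codomain depends on [t], so the witnesses are picked one by one with [cid]. *)
have [LG dG] : exists LG : forall t, 'M[R]_m * 'cV[R]_nx -> 'cV[R]_(ncstr P t),
    forall t, (0 < t <= horizon P)%N ->
    diff_within [set p : 'M[R]_m * 'cV[R]_nx | G p.1]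
      (fun p => cstr P t p.1 p.2) (q t, x t) (LG t).
  by exists (fun t => sval (cid (exG t))) => t; exact: (svalP (cid (exG t))).
have [l0 [l [[l0ge lge] lslack lpos lopt]]] :=
  fritz_john lieG lie_g Gstep cvx opt dS dF dC dE dG.
(* Dividing all multipliers by [k] and changing their sign makes [nu0] equal to -1 when [l0 > 0] and
   to 0 otherwise. *)
pose k : R := if 0 < l0 then l0 else 1.
have k0 : 0 < k by rewrite /k; case: ifP.
pose nu0 : R := - (l0 / k).
pose mu t : 'rV[R]_(ncstr P t) := \row_j (- (l t j / k)).
have [||z [[rhoN xiN] zstep]] := @backward_recursion (dualv g * 'rV[R]_nx) (horizon P)
  (fun z => (forall w : subvs_of g,
      DlogStar O (gstep P (horizon P).-1 (q (horizon P).-1) (x (horizon P).-1)) z.1 w =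
      nu0 * LE (q (horizon P) *m vsval w, 0) +
      (mu (horizon P) *m LG (horizon P) (q (horizon P) *m vsval w, 0)) 0 0) /\
    z.2 = nu0 *: Dxcend P (q (horizon P)) (x (horizon P)) +
      muDxg (mu (horizon P)) (q (horizon P)) (x (horizon P)))
  (fun t z z' => (forall w : subvs_of g,
      DlogStar O (gstep P t.-1 (q t.-1) (x t.-1)) z'.1 w =
      adjoint_rhs (P := P) (t := t) (q := q t) (x := x t) (nu_ := nu0) (zeta := z.1)
        (xi := z.2) (LS := LS t) (LF := LF t) (LC := LC t) (LL := LL t)
        (LG := LG t) (mu := mu t) w) /\
    z'.2 = DxH P O nu0 t z.1 z.2 (q t) (x t) (u t) + muDxg (mu t) (q t) (x t))
  N0.
- have NN : (0 < horizon P <= horizon P)%N by rewrite N0 leqnn.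
  have tN : ((horizon P).-1 < horizon P)%N by rewrite prednK.
  pose r (w : subvs_of g) : R^o := nu0 * LE (q (horizon P) *m vsval w, 0) +
    (mu (horizon P) *m LG (horizon P) (q (horizon P) *m vsval w, 0)) 0 0.
  have lr : linear r.
    move=> c a b; rewrite /r.
    have -> : (q (horizon P) *m vsval (c *: a + b), 0) =
        c *: (q (horizon P) *m vsval a, 0) + (q (horizon P) *m vsval b, 0)
        :> 'M[R]_m * 'cV[R]_nx.
      have -> : vsval (c *: a + b) = c *: vsval a + vsval b by exact: linearP.
      by congr (_, _); rewrite /= ?scaler0 ?addr0// mulmxDr -scalemxAr.
    rewrite (diff_within_linear dE) (diff_within_linear (dG _ NN)).
    rewrite mulmxDr -scalemxAr !mxE.
    have E (a1 a2 b1 b2 d : R) : d * (c * a1 + a2) + (c * b1 + b2) =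
      c * (d * a1 + b1) + (d * a2 + b2) by ring.
    exact: E.
  pose rL : {linear subvs_of g -> R^o} :=
    HB.pack r (GRing.isLinear.Build _ _ _ _ r lr).
  have [zt ztE] := DlogStar_surj lieG lie_g Og expO diffO (Es _ tN) (dL _ tN) (linfun rL).
  exists (zt, nu0 *: Dxcend P (q (horizon P)) (x (horizon P)) +
      muDxg (mu (horizon P)) (q (horizon P)) (x (horizon P))).
  by split=> // w; rewrite ztE lfunE.
- move=> t [zt xt] /andP[t0 tN] /=.
  have tN' := ltnW tN.
  have tP : (t.-1 < horizon P)%N by rewrite (leq_ltn_trans (leq_pred t)).
  have tNN : (0 < t <= horizon P)%N by rewrite t0.
  have lr := @adjoint_rhs_linear R m nx nu P G g O expO t (q t) (x t) (u t) nu0 zt xt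
    (LS t) (LF t) (LC t) (LL t) (Gq _ tN') (Gstep _ tN) (Es _ tN) (dS _ tN) (dF _ tN)
    (dC _ tN) (dL _ tN) (LG t) (mu t) (dG _ tNN).
  pose rL : {linear subvs_of g -> R^o} :=
    HB.pack (adjoint_rhs (P := P) (t := t) (q := q t) (x := x t) (nu_ := nu0) (zeta := zt)
        (xi := xt) (LS := LS t) (LF := LF t) (LC := LC t) (LL := LL t)
        (LG := LG t) (mu := mu t)) (GRing.isLinear.Build _ _ _ _ _ lr).
  have [zt' ztE] := DlogStar_surj lieG lie_g Og expO diffO (Es _ tP) (dL _ tP) (linfun rL).
  exists (zt', DxH P O nu0 t zt xt (q t) (x t) (u t) + muDxg (mu t) (q t) (x t)).
  by split=> // w; rewrite ztE lfunE.
pose zeta t := (z t).1; pose xi t := (z t).2.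
have expZ t : (t < horizon P)%N ->
    expmx (vsval (DzetaH P O nu0 t (zeta t) (xi t) (q t) (x t) (u t))) =
    gstep P t (q t) (x t).
  by move=> tN; exact: (exp_DzetaH Og diffO (Es _ tN)).
exists zeta, xi, mu, nu0 => N Dz Dxi Dq Dx Du rho.
have NN : (0 < N <= N)%N by rewrite N0 leqnn.
split; [|split; [|split; [|split; [|split; [|split; [|split]]]]]].
- rewrite /nu0 /k; case: ifP => [l0gt|l0le]; first by left; rewrite divff// gt_eqF.
  by right; have -> : l0 = 0; [apply/eqP; rewrite eq_le l0ge leNgt l0le|rewrite mul0r oppr0].
- by move=> t tN; rewrite /Dz expZ// /Dxi DxiHE; have [-> -> _] := dynE _ tN.
- move=> t tN; have [rhot xit] := zstep t tN; split; last exact: xit.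
  have /andP[t0 tN'] := tN; have tNN : (0 < t <= N)%N by rewrite t0 ltnW.
  apply/funext => w; rewrite /rho expZ; last by rewrite (leq_ltn_trans (leq_pred t)).
  rewrite rhot; symmetry.
  exact: (adjoint_rhsE lieG lie_g Og expO diffO (Gq _ (ltnW tN')) (Gstep _ tN')
    (Es _ tN') (dS _ tN') (dF _ tN') (dC _ tN') (dL _ tN') (dG _ tNN) w).
- split; last exact: xiN.
  apply/funext => w; rewrite /rho expZ ?prednK// rhoN /TPhiStar TPhiE /=.
  by rewrite (DqcendE lieG lie_g GqN dE) ?subvsP// (muDqgE lieG lie_g GqN (dG _ NN)) ?subvsP.
- move=> t tN w Uw.
  rewrite /Du (DuHE expO (Gq _ (ltnW tN)) (Gstep _ tN) (Es _ tN) (dS _ tN) (dF _ tN)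
    (dC _ tN) (dL _ tN)).
  (* Only the control at time [t] is varied, so the left side of [adjoint_identity] reduces to one
     term. *)
  pose v i : 'cV[R]_nu := if i == t then w - u t else 0.
  have vC i : (i < N)%N -> ctrl P i (u i + v i).
    move=> iN; rewrite /v; case: eqP => [->|_]; first by rewrite addrC subrK.
    by rewrite addr0; have [_ _] := dynE _ iN.
  have := adjoint_identity lieG lie_g Og expO diffO Gstep adm Es dS dF dC dL dE dG
    (fun i iN => (zstep i iN).1) (fun i iN => (zstep i iN).2) rhoN xiN v N0.
  rewrite (bigD1 (Ordinal tN))//= big1 => [|i it]; last first.
    have -> : v i = 0 by rewrite /v; case: eqP => // ti; case/eqP: it; exact/val_inj.
    have iN := ltn_ord i.
    have lH := @dHam_linear R m nx nu P G g O expO i (q i) (x i) (u i) nu0 (zeta i) (xi i)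
      (LS i) (LF i) (LC i) (LL i) (Gq _ (ltnW iN)) (Gstep _ iN) (Es _ iN) (dS _ iN)
      (dF _ iN) (dC _ iN) (dL _ iN).
    by have := lH (-1) 0 0; rewrite scaler0 addr0 scaleN1r addNr.
  rewrite addr0 {1}/v eqxx => ->.
  (* By the normalization, the right side is minus the nonnegative Fritz John combination, divided
     by [k]. *)
  have := lopt v vC; rewrite /dcost.
  set A := _ + LE _; set B := \sum_(i < N) \sum_j _ => AB.
  have -> : \sum_(i < N) (mu i.+1 *m LG i.+1 (velocity (P := P) (q := q) (x := x)
      (LS := LS) (LF := LF) v i.+1)) 0 0 = - (B / k).
    rewrite /B mulr_suml -sumrN; apply: eq_bigr => i _.
    rewrite mxE mulr_suml -sumrN; apply: eq_bigr => j _.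
    by rewrite mxE mulNr mulrAC.
  have -> : nu0 * A - B / k = - ((l0 * A + B) / k).
    by rewrite /nu0 mulNr mulrDl opprD [l0 / k * A]mulrAC.
  by rewrite oppr_le0 divr_ge0// ltW.
- move=> t tN j; rewrite mxE mulNr mulrAC lslack//.
  by rewrite mul0r oppr0.
- by move=> t tN j; rewrite mxE oppr_le0 divr_ge0// ltW.
(* A positive multiplier exists: it shows up as a nonzero [nu0] or as a nonzero entry of some
   [mu t]. *)
case=> _ mu0 nu00.
case: lpos => [l0gt|[t [j [tN lt0]]]].
  by move/eqP: nu00; rewrite /nu0 oppr_eq0 mulf_eq0 invr_eq0 !gt_eqF.
have /rowP/(_ j)/eqP := mu0 t tN.
by rewrite !mxE oppr_eq0 mulf_eq0 invr_eq0 !gt_eqF.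
Qed.
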